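(* Let $\alpha\in(0,2)$, $\alpha\ne1$, let $W_1\sim\mathcal{N}(\mu_W,\sigma_W^2)$ with $\mathbb{E}[W_1^2]>0$, and let $Z_{(c,\infty)}$ be as in the context. Then, for $s\in\mathbb{R}$ and $c>0$, the characteristic function of $Z_{(c,\infty)}$ is $$\phi_{Z_{(c,\infty)}}(s)=\exp\left(-\frac{s^2}{2}+\sum_{k=3}^\infty\bar z_ks^k\right),$$ where $$\bar z_k:=\frac{i^k}{k!}\,\frac{\mathbb{E}[W_1^k]\frac{\alpha}{k-\alpha}}{\left(\mathbb{E}[W_1^2]\frac{\alpha}{2-\alpha}\right)^{k/2}}\,c^{1-k/2},\qquad k\ge3.$$
   Context: Let $\{\Gamma_j\}_{j\ge1}$ be the successive arrival times of a unit rate Poisson process on $(0,\infty)$, and let $\{W_j\}_{j\ge 1}$ be i.i.d. $\mathcal{N}(\mu_W,\sigma_W^2)$ random variables independent of $\{\Gamma_j\}$. Define constants $b_j^{(\alpha)}=\frac{\alpha}{\alpha-1}\left(j^{(\alpha-1)/\alpha}-(j-1)^{(\alpha-1)/\alpha}\right)$ if $\alpha\in(1,2)$ and $b_j^{(\alpha)}=0$ if $\alpha\in(0,1)$. For $c>0$ and an integer $d>c$ let $$R_{(c,d)}:=\sum_{j:\Gamma_j\in(c,d)}W_j\Gamma_j^{-1/\alpha}-\mathbb{E}[W_1]\sum_{j=1}^{d}b_j^{(\alpha)}$$ (an empty sum is $0$), and let $R_{(c,\infty)}$ denote the limit in distribution of $R_{(c,d)}$ as $d\to\infty$ through the integers (this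 limit exists). Define $$m_{(c,\infty)}:=\mathbb{E}[W_1]\frac{\alpha}{1-\alpha}c^{\frac{\alpha-1}{\alpha}},\qquad S^2_{(c,\infty)}:=\mathbb{E}[W_1^2]\frac{\alpha}{2-\alpha}c^{\frac{\alpha-2}{\alpha}},\qquad Z_{(c,\infty)}:=\frac{R_{(c,\infty)}-m_{(c,\infty)}}{S_{(c,\infty)}}.$$ *)

(* Defs.v *)
From HB Require Import structures.
From mathcomp Require Import all_boot all_order all_algebra.
From mathcomp Require Import all_classical all_reals all_analysis.
From mathcomp Require Export complex.

(* [R[i]] gets its topology through the alias [R[i]^o]. *)

Set Implicit Arguments.
Unset Strict Implicit.
Unset Printing Implicit Defensive.

Import Order.TTheory GRing.Theory Num.Theory.
Import numFieldTopology.Exports numFieldNormedType.Exports.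

Local Open Scope classical_set_scope.
Local Open Scope ring_scope.

Section probability_notions.
Context d (T : measurableType d) (R : realType) (P : probability T R).

Definition mean (X : T -> R) : R := fine ('E_P[X])%E.

Definition mutually_independent (I : eqType) d' (U : measurableType d')
    (X : I -> T -> U) : Prop :=
  forall (J : seq I) (A : I -> set U), uniq J ->
    (forall i, measurable (A i)) ->
    P (\big[setI/setT]_(i <- J) (X i @^-1` A i)) =
    (\prod_(i <- J) P (X i @^-1` A i))%E.

(* Independence of the sigma-algebras generated by the whole families X and Y,
   expressed on the generating pi-systems of finite-dimensional cylinders. *)
Definition independent_families (I I' : eqType) d1 d2
    (U1 : measurableType d1) (U2 : measurableType d2)
    (X : I -> T -> U1) (Y : I' -> T -> U2) : Prop :=
  forall (J : seq I) (K : seq I') (A : I -> set U1) (B : I' -> set U2),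
    (forall i, measurable (A i)) -> (forall k, measurable (B k)) ->
    P ((\big[setI/setT]_(i <- J) (X i @^-1` A i)) `&`
       (\big[setI/setT]_(k <- K) (Y k @^-1` B k))) =
    (P (\big[setI/setT]_(i <- J) (X i @^-1` A i)) *
     P (\big[setI/setT]_(k <- K) (Y k @^-1` B k)))%E.

(* A process indexed by the nonnegative times. The increments are truncated
   differences of naturals, which monotonicity makes genuine. *)
Definition unit_poisson_process (N : R -> {RV P >-> nat}) : Prop :=
  [/\ {ae P, forall w, N 0 w = 0%N},
      {ae P, forall w, forall s t, 0 <= s -> s <= t -> (N s w <= N t w)%N},
      forall s t k, 0 <= s -> s < t ->
        P [set w | (N t w - N s w)%N = k] = (poisson_pmf (t - s) k)%:E &
      forall t : nat -> R, 0 <= t 0%N -> nondecreasing_seq t ->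
        mutually_independent (fun i w => (N (t i.+1) w - N (t i) w)%N)].

(* [Gamma j] is the (j+1)-st arrival time inf {t | N_t >= j + 1}. *)
Definition unit_poisson_arrivals (Gamma : nat -> {RV P >-> R}) : Prop :=
  exists2 N : R -> {RV P >-> nat}, unit_poisson_process N &
    {ae P, forall w, forall t j, 0 <= t -> (Gamma j w <= t) = (j < N t w)%N}.

Definition charfun (X : T -> R) (s : R) : R[i] :=
  (mean (fun w => cos (s * X w)) +i* mean (fun w => sin (s * X w)))%C.

End probability_notions.

(* N(mu, sigma^2); the library's [normal_prob mu 0] is not the Dirac mass. *)
Definition gaussian_law (R : realType) (mu sigma : R) : set R -> \bar R :=
  if sigma == 0 then \d_mu else normal_prob mu sigma.

Definition cvg_in_distribution (R : realType)
    d (T : measurableType d) (P : probability T R) (X : nat -> T -> R)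
    d' (T' : measurableType d') (P' : probability T' R) (Y : T' -> R) : Prop :=
  forall f : R -> R, continuous f -> bounded_fun f ->
    ('E_P[f \o X n] @[n --> \oo] --> 'E_P'[f \o Y])%E.

Definition cexp (R : realType) (z : R[i]) : R[i] :=
  let: (x +i* y)%C := z in ((expR x)%:C * (cos y +i* sin y))%C.

Section residual.
Context d (T : measurableType d) (R : realType) (P : probability T R).
Variables (alpha : R) (Gamma W : nat -> {RV P >-> R}).

Definition b_coef (j : nat) : R :=
  if 1 < alpha then
    alpha / (alpha - 1) * (j%:R `^ ((alpha - 1) / alpha) -
                           j.-1%:R `^ ((alpha - 1) / alpha))
  else 0.

(* [Gamma] and [W] are indexed from 0, so [Gamma j] and [W j] stand for
   Gamma_(j+1) and W_(j+1). The sum over j is a finitely supported one, which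
   is 0 on the null event where infinitely many arrivals lie in (c, D). *)
Definition residual (c : R) (D : nat) (w : T) : R :=
  \sum_(j \in [set j | c < Gamma j w < D%:R])
     W j w * Gamma j w `^ (- alpha^-1)
  - mean P (W 0%N) * \sum_(1 <= j < D.+1) b_coef j.

Definition residual_mean (c : R) : R :=
  mean P (W 0%N) * (alpha / (1 - alpha)) * c `^ ((alpha - 1) / alpha).

Definition residual_var (c : R) : R :=
  mean P (fun w => W 0%N w ^+ 2) * (alpha / (2 - alpha)) *
  c `^ ((alpha - 2) / alpha).

Definition zbar (c : R) (k : nat) : R[i] :=
  'i%C ^+ k / k`!%:R *
  ((mean P (fun w => W 0%N w ^+ k) * (alpha / (k%:R - alpha)) /
    (mean P (fun w => W 0%N w ^+ 2) * (alpha / (2 - alpha))) `^ (k%:R / 2) *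
    c `^ (1 - k%:R / 2))%:C)%C.

Definition zbar_partial_sum (c s : R) (n : nat) : R[i]^o :=
  \sum_(3 <= k < n) zbar c k * (s%:C)%C ^+ k.

End residual.

(* Main.v *)
(* Poisson sums are compared with Riemann sums. Cut (c, D) into n equal pieces and
   replace the jump size x^(-1/alpha) by its value at the right end of the piece.
   As the marks W_j are independent of the arrivals, each W_j may be replaced by
   its characteristic function chi, and what remains is a product of powers of
   values of chi whose exponents are the independent Poisson increments. Since
   E[z^Y] = exp(h (z - 1)) + O(h^2) for Y Poisson of mean h, the characteristic
   function of the sum over (c, D) at u is the exponential of the limit of the
   Riemann sums of chi(u x^(-1/alpha)) - 1.

   Gaussian variables have exponential moments, so chi is the sum of its moment
   series, and the Riemann sums converge term by term with an error dominated by
   a convergent series: the exponent is the sum over k >= 1 of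
   (i u)^k E[W^k] / k! * (G_k(D) - G_k(c)), with G_k a primitive of x^(-k/alpha).
   As D tends to infinity, G_k(D) tends to 0 for k >= 2, and for k = 1 either
   tends to 0 (alpha < 1) or is cancelled by the compensator (alpha > 1). The
   terms k = 1 and k = 2 at u = s / S give the centring and -s^2/2. *)

Require Import Defs.
From HB Require Import structures.
From mathcomp Require Import all_boot all_order all_algebra.
From mathcomp Require Import all_classical all_reals all_analysis.
From mathcomp Require Import measurable_realfun ring lra zify.
Import Order.TTheory GRing.Theory Num.Theory.
Import numFieldTopology.Exports numFieldNormedType.Exports.
Import Normc.
Set Implicit Arguments.
Unset Strict Implicit.
Unset Printing Implicit Defensive.
Local Open Scope classical_set_scope.
Local Open Scope ring_scope.

(** * Complex numbers *)

(** The number of jumps before D is random, whereas independence speaks of products of fixed length.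
    The sum is therefore cut at M jumps, at the cost of a multiple of the probability of more than M
    arrivals by time D; the mesh tends to 0 with M fixed, and only then does M grow. Once the jump
    sizes are discretised, an arrival matters only through the index of its piece, so conditioning
    on the arrivals reduces to a finite expansion and needs no product measure.

    All limits of the exponent rest on one estimate: if the k-th coefficient is off by at most B
    c^(-k/alpha) for every k >= 1, the sum is off by at most a constant times B. The Riemann error
    (B of the order of the mesh) and the tail at D both have this form, since c^(-1/alpha) bounds
    the jump sizes. As alpha is not an integer, every primitive is a power and no logarithm appears.

    The limit law enters only through the test functions cos and sin. *)

Section complex_analysis.
Context {R : realType}.
Implicit Types (z l : R[i]) (t : R).

Definition cis t : R[i] := (cos t +i* sin t)%C.

Lemma ReD z1 z2 : complex.Re (z1 + z2) = complex.Re z1 + complex.Re z2.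
Proof. by case: z1; case: z2. Qed.

Lemma ImD z1 z2 : complex.Im (z1 + z2) = complex.Im z1 + complex.Im z2.
Proof. by case: z1; case: z2. Qed.

Lemma ReN z : complex.Re (- z) = - complex.Re z.
Proof. by case: z. Qed.

Lemma ImN z : complex.Im (- z) = - complex.Im z.
Proof. by case: z. Qed.

Lemma ReM z1 z2 : complex.Re (z1 * z2) =
  complex.Re z1 * complex.Re z2 - complex.Im z1 * complex.Im z2.
Proof. by case: z1; case: z2. Qed.

Lemma ImM z1 z2 : complex.Im (z1 * z2) =
  complex.Re z1 * complex.Im z2 + complex.Im z1 * complex.Re z2.
Proof. by case: z1 => a b; case: z2 => c d /=; ring. Qed.

Lemma Re_sum I (r : seq I) (Q : pred I) (F : I -> R[i]) :
  complex.Re (\sum_(i <- r | Q i) F i) = \sum_(i <- r | Q i) complex.Re (F i).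
Proof. by apply: (big_morph _ ReD). Qed.

Lemma Im_sum I (r : seq I) (Q : pred I) (F : I -> R[i]) :
  complex.Im (\sum_(i <- r | Q i) F i) = \sum_(i <- r | Q i) complex.Im (F i).
Proof. by apply: (big_morph _ ImD). Qed.

Definition ReImE := (ReD, ImD, ReN, ImN, ReM, ImM).

Lemma complex_eq z1 z2 : complex.Re z1 = complex.Re z2 ->
  complex.Im z1 = complex.Im z2 -> z1 = z2.
Proof. by case: z1 => a b; case: z2 => c d /= -> ->. Qed.

Lemma cisD t1 t2 : cis (t1 + t2) = cis t1 * cis t2.
Proof. by apply: complex_eq; rewrite ReImE /= ?cosD ?sinD; ring. Qed.

Lemma cis0 : cis 0 = 1.
Proof. by rewrite /cis cos0 sin0. Qed.

Lemma cis_sum I (r : seq I) (Q : pred I) (F : I -> R) :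
  cis (\sum_(i <- r | Q i) F i) = \prod_(i <- r | Q i) cis (F i).
Proof. exact: (big_morph _ cisD cis0). Qed.

Lemma normc_ge0 z : 0 <= normc z.
Proof. by case: z => a b /=; exact: sqrtr_ge0. Qed.

Lemma normc_cis t : normc (cis t) = 1.
Proof. by rewrite /cis /= cos2Dsin2 sqrtr1. Qed.

Lemma normc_real t : normc (t%:C)%C = `|t|.
Proof. by rewrite /= expr0n/= addr0 sqrtr_sqr. Qed.

Lemma Re_le_normc z : `|complex.Re z| <= normc z.
Proof.
by case: z => a b /=; rewrite -sqrtr_sqr ler_wsqrtr// lerDl sqr_ge0.
Qed.

Lemma Im_le_normc z : `|complex.Im z| <= normc z.
Proof.
by case: z => a b /=; rewrite -sqrtr_sqr ler_wsqrtr// lerDr sqr_ge0.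
Qed.

Lemma normc_le z : normc z <= `|complex.Re z| + `|complex.Im z|.
Proof.
case: z => a b /=; rewrite -[leRHS]ger0_norm ?addr_ge0// -sqrtr_sqr.
rewrite ler_wsqrtr// sqrrD !real_normK ?num_real//.
by rewrite addrAC lerDl mulrn_wge0// mulr_ge0.
Qed.

Lemma normcX z n : normc (z ^+ n) = normc z ^+ n.
Proof. by elim: n => [|n IH]; rewrite ?expr0 ?normc1// !exprS normcM IH. Qed.

Lemma ler_normc_sum I (r : seq I) (Q : pred I) (F : I -> R[i]) :
  normc (\sum_(i <- r | Q i) F i) <= \sum_(i <- r | Q i) normc (F i).
Proof.
elim/big_ind2 : _ => [|x1 x2 y1 y2 h1 h2|//]; first by rewrite normc0.
by apply: le_trans (le_normcD _ _) _; exact: lerD.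
Qed.

Lemma normc_prod I (r : seq I) (Q : pred I) (F : I -> R[i]) :
  normc (\prod_(i <- r | Q i) F i) = \prod_(i <- r | Q i) normc (F i).
Proof. by apply: (big_morph _ (@normcM R)); exact: normc1. Qed.

Lemma normcB z1 z2 : normc (z1 - z2) = normc (z2 - z1).
Proof. by rewrite -normcN opprB. Qed.

Lemma normc_prod_le1 (I : eqType) (r : seq I) (F : I -> R[i]) :
  (forall i, i \in r -> normc (F i) <= 1) -> normc (\prod_(i <- r) F i) <= 1.
Proof.
elim: r => [|i r IH] F1; first by rewrite big_nil normc1.
rewrite big_cons normcM mulr_ile1 ?normc_ge0 ?F1 ?mem_head// IH// => j jr.
by apply: F1; rewrite inE jr orbT.
Qed.

(** Exchange the factors one at a time; the other factors have norm at most 1. Errors of order h^2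
    per piece thus add up to order h. *)
Lemma normc_prodB (I : eqType) (r : seq I) (F G : I -> R[i]) :
  (forall i, i \in r -> normc (F i) <= 1) ->
  (forall i, i \in r -> normc (G i) <= 1) ->
  normc (\prod_(i <- r) F i - \prod_(i <- r) G i) <=
  \sum_(i <- r) normc (F i - G i).
Proof.
elim: r => [|i r IH] hF hG; first by rewrite !big_nil subrr normc0.
rewrite !big_cons.
have -> : F i * \prod_(j <- r) F j - G i * \prod_(j <- r) G j =
  (F i - G i) * \prod_(j <- r) F j
  + G i * (\prod_(j <- r) F j - \prod_(j <- r) G j) by ring.
apply: le_trans (le_normcD _ _) _; rewrite !normcM; apply: lerD.
  rewrite ler_piMr ?normc_ge0// normc_prod_le1// => j jr.
  by apply: hF; rewrite inE jr orbT.
apply: (@le_trans _ _ (1 * normc (\prod_(j <- r) F j - \prod_(j <- r) G j))).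
  by rewrite ler_wpM2r ?normc_ge0// hG// mem_head.
by rewrite mul1r IH// => j jr; [apply: hF|apply: hG]; rewrite inE jr orbT.
Qed.

(** Componentwise, so that real limit theorems apply directly; [ccvg_cvg] returns to the topology of
    [R[i]^o]. *)
Definition ccvg (z : nat -> R[i]) l :=
  ((fun n => complex.Re (z n)) @ \oo --> complex.Re l) /\
  ((fun n => complex.Im (z n)) @ \oo --> complex.Im l).

Lemma ccvg_cst l : ccvg (fun=> l) l.
Proof. by split; exact: cvg_cst. Qed.

Lemma ccvgD (z w : nat -> R[i]) l m : ccvg z l -> ccvg w m -> ccvg (fun n => z n + w n) (l + m).
Proof.
move=> [h1 h2] [h3 h4]; split.
- by rewrite ReD; under eq_fun do rewrite ReD; exact: cvgD.
- by rewrite ImD; under eq_fun do rewrite ImD; exact: cvgD.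
Qed.

Lemma ccvgN (z : nat -> R[i]) l : ccvg z l -> ccvg (fun n => - z n) (- l).
Proof.
move=> [h1 h2]; split.
- by rewrite ReN; under eq_fun do rewrite ReN; exact: cvgN.
- by rewrite ImN; under eq_fun do rewrite ImN; exact: cvgN.
Qed.

Lemma ccvgM (z w : nat -> R[i]) l m : ccvg z l -> ccvg w m -> ccvg (fun n => z n * w n) (l * m).
Proof.
move=> [h1 h2] [h3 h4]; split.
- rewrite ReM; under eq_fun do rewrite ReM.
  by apply: cvgB; exact: cvgM.
- rewrite ImM; under eq_fun do rewrite ImM.
  by apply: cvgD; exact: cvgM.
Qed.

Lemma ccvg_unique (z : nat -> R[i]) l m : ccvg z l -> ccvg z m -> l = m.
Proof.
move=> [h1 h2] [h3 h4].
by apply: complex_eq; [exact: cvg_unique h1 h3|exact: cvg_unique h2 h4].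
Qed.

Lemma ccvg_normcB (z : nat -> R[i]) l : ccvg z l ->
  (fun n => normc (z n - l)) @ \oo --> (0 : R).
Proof.
move=> zl.
have [h1 h2] := ccvgD zl (ccvgN (ccvg_cst l)).
rewrite subrr in h1 h2.
have h : (fun n => `|complex.Re (z n - l)| + `|complex.Im (z n - l)|) @ \oo -->
  (0 : R).
  rewrite -[X in _ --> X](addr0 0) -{1}(@normr0 _ R) -{2}(@normr0 _ R).
  by apply: cvgD; exact: cvg_norm.
refine (squeeze_cvgr _ (cvg_cst 0) h).
by near=> n; rewrite normc_ge0 normc_le.
Unshelve. all: by end_near. Qed.

Lemma squeeze_ccvg (z : nat -> R[i]) l (e : nat -> R) :
  (\forall n \near \oo, normc (z n - l) <= e n) ->
  e @ \oo --> 0 -> ccvg z l.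
Proof.
move=> ze e0.
by split; apply/cvgrPdist_le => eps eps0; near=> n;
  (apply: le_trans (_ : e n <= eps); last by
     apply: le_trans (ler_norm _) _; near: n; apply: cvgr0_norm_le);
  (apply: le_trans (near ze n _) => //);
  rewrite distrC; [rewrite -ReN -ReD; exact: Re_le_normc|
                   rewrite -ImN -ImD; exact: Im_le_normc].
Unshelve. all: by end_near. Qed.

Lemma ler_normcB z1 z2 : `|normc z1 - normc z2| <= normc (z1 - z2).
Proof.
rewrite ler_norml; apply/andP; split.
  rewrite lerNl opprB lerBlDr normcB.
  by rewrite -{1}(subrK z1 z2); exact: le_normcD.
by rewrite lerBlDr -{1}(subrK z2 z1); exact: le_normcD.
Qed.

Lemma ccvg_normc (z : nat -> R[i]) l : ccvg z l -> (fun n => normc (z n)) @ \oo --> normc l.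
Proof.
move=> /ccvg_normcB h; apply/cvgrPdist_le => e e0; near=> n.
rewrite distrC; apply: le_trans (ler_normcB _ _) _.
apply: le_trans (ler_norm _) _.
by near: n; apply: cvgr0_norm_le.
Unshelve. all: by end_near. Qed.

(** * The complex exponential and complex series *)

Lemma cexpE z : cexp z = ((expR (complex.Re z))%:C)%C * cis (complex.Im z).
Proof. by case: z. Qed.

Lemma normc_cexp z : normc (cexp z) = expR (complex.Re z).
Proof. by rewrite cexpE normcM normc_cis mulr1 normc_real ger0_norm ?expR_ge0. Qed.

Lemma cexpD z1 z2 : cexp (z1 + z2) = cexp z1 * cexp z2.
Proof. by rewrite !cexpE ReD ImD expRD cisD rmorphM/=; ring. Qed.

Lemma cexp0 : cexp (0 : R[i]) = 1.
Proof. by rewrite cexpE /= expR0 cis0 mulr1. Qed.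

Lemma cexp_sum I (r : seq I) (Q : pred I) (F : I -> R[i]) :
  cexp (\sum_(i <- r | Q i) F i) = \prod_(i <- r | Q i) cexp (F i).
Proof. exact: (big_morph _ cexpD cexp0). Qed.

Lemma cis_cexp t : cis t = cexp ('i%C * (t%:C)%C).
Proof. rewrite cexpE ReM ImM /= (_ : 0 * t - 1 * 0 = 0) 1?(_ : 0 * 0 + 1 * t = t);
  [by rewrite expR0 mul1r|by ring|by ring]. Qed.

Lemma ccvg_cis (x : nat -> R) a : x @ \oo --> a -> ccvg (fun n => cis (x n)) (cis a).
Proof.
move=> xa; split => /=.
  by apply: continuous_cvg => //; exact: continuous_cos.
by apply: continuous_cvg => //; exact: continuous_sin.
Qed.

Lemma ccvg_cexp (z : nat -> R[i]) l : ccvg z l -> ccvg (fun n => cexp (z n)) (cexp l).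
Proof.
move=> [h1 h2]; rewrite cexpE.
rewrite (_ : (fun n => cexp (z n)) = (fun n => ((expR (complex.Re (z n)))%:C)%C
  * cis (complex.Im (z n)))); last by apply/funext => n; rewrite cexpE.
apply: ccvgM; last exact: ccvg_cis.
split => /=; last exact: cvg_cst.
by apply: continuous_cvg => //; exact: continuous_expR.
Qed.

Lemma near_eq_ccvg (z w : nat -> R[i]) l :
  (\forall n \near \oo, z n = w n) -> ccvg z l -> ccvg w l.
Proof.
move=> e [h1 h2]; split; [apply: cvg_trans h1|apply: cvg_trans h2];
  by apply: near_eq_cvg; apply: filterS e => n ->.
Qed.

(** A relation between series and sum: linear operations on series then carry their convergence with
    them. *)
Definition has_csum (z : nat -> R[i]) l :=
  ccvg (fun n => \sum_(0 <= k < n) z k) l.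

Lemma has_csum_exists (z : nat -> R[i]) (y : nat -> R) : (forall k, normc (z k) <= y k) ->
  cvgn (series y) -> exists l, has_csum z l.
Proof.
move=> zy cy.
have y0 k : 0 <= y k by apply: le_trans (zy k); exact: normc_ge0.
have cz (p : R[i] -> R) : (forall z, `|p z| <= normc z) -> cvgn (series (p \o z)).
  move=> hp; apply: normed_cvg; apply: series_le_cvg cy => //.
  - by move=> k /=; exact: normr_ge0.
  - by move=> k /=; apply: le_trans (hp _) (zy k).
have /cvg_ex[a ha] := cz _ Re_le_normc; have /cvg_ex[b hb] := cz _ Im_le_normc.
exists (a +i* b)%C; split => /=.
- by under eq_fun do rewrite Re_sum.
- by under eq_fun do rewrite Im_sum.
Qed.

Lemma has_csum_normc (z : nat -> R[i]) l (y : nat -> R) Y : has_csum z l ->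
  (forall k, normc (z k) <= y k) -> series y @ \oo --> Y -> normc l <= Y.
Proof.
move=> /ccvg_normc zl zy yY.
apply: (ler_cvg_to zl yY); near=> n.
by apply: le_trans (ler_normc_sum _ _ _) _; exact: ler_sum.
Unshelve. all: by end_near. Qed.

Lemma has_csumD (z w : nat -> R[i]) l m : has_csum z l -> has_csum w m ->
  has_csum (fun k => z k + w k) (l + m).
Proof.
by move=> zl wm; rewrite /has_csum; under eq_fun do rewrite big_split/=; exact: ccvgD.
Qed.

Lemma has_csumZ a (z : nat -> R[i]) l : has_csum z l -> has_csum (fun k => a * z k) (a * l).
Proof.
move=> zl; rewrite /has_csum; under eq_fun do rewrite -mulr_sumr.
by apply: ccvgM => //; exact: ccvg_cst.
Qed.

Lemma has_csumB (z w : nat -> R[i]) l m : has_csum z l -> has_csum w m ->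
  has_csum (fun k => z k - w k) (l - m).
Proof.
move=> zl wm; rewrite -mulN1r.
have := has_csumD zl (has_csumZ (-1) wm).
by congr has_csum; apply/funext => k; rewrite mulN1r.
Qed.

Lemma has_csum_big I (r : seq I) (z : I -> nat -> R[i]) (l : I -> R[i]) :
  (forall i, has_csum (z i) (l i)) ->
  has_csum (fun k => \sum_(i <- r) z i k) (\sum_(i <- r) l i).
Proof.
move=> h; elim: r => [|i r IH].
  rewrite big_nil; under eq_fun do rewrite big_nil.
  by rewrite /has_csum; under eq_fun do rewrite big1//; exact: ccvg_cst.
by rewrite big_cons; under eq_fun do rewrite big_cons; exact: has_csumD.
Qed.

(** Used to remove or correct one term of a series. *)
Lemma has_csum_single n (a : R[i]) :
  has_csum (fun k => if k == n then a else 0) a.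
Proof.
have hs m : (n < m)%N -> \sum_(0 <= k < m) (if k == n then a else 0) = a.
  by move=> nm; rewrite -big_mkcond/= big_nat1_eq leq0n nm.
by split; apply: cvg_near_cst; near=> m; rewrite hs//; near: m;
  exact: nbhs_infty_gt.
Unshelve. all: by end_near. Qed.

Definition icoef k : R[i] := 'i%C ^+ k / k`!%:R.

Lemma natrC n : (n%:R : R[i]) = ((n%:R : R)%:C)%C.
Proof. by rewrite rmorph_nat. Qed.

Lemma normc_icoef k : normc (icoef k) = (k`!%:R)^-1.
Proof.
rewrite /icoef normcM normcX normcV natrC normc_real normr_nat.
by rewrite /= expr0n expr1n add0r sqrtr1 expr1n mul1r.
Qed.

Lemma icoef0 : icoef 0 = 1.
Proof. by rewrite /icoef expr0 divr1. Qed.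

Lemma icoef1 : icoef 1 = 'i%C.
Proof. by rewrite /icoef expr1 divr1. Qed.

(** The two components are written as in [cos_coeff] and [sin_coeff], whose series are matched with
    that of [cis] below. *)
Lemma exprIC k : ('i%C : R[i]) ^+ k =
  ((~~ odd k)%:R * (-1) ^+ k./2 +i* ((odd k)%:R * (-1) ^+ k.-1./2))%C.
Proof.
rewrite -{1}(odd_double_half k) exprD -mul2n exprM sqr_i.
have -> : (-1 : R[i]) ^+ k./2 = (((-1) ^+ k./2)%:C)%C by rewrite rmorphXn rmorphN1.
case ko: (odd k) => /=.
  rewrite expr1 (_ : k.-1./2 = k./2); last first.
    by move: ko; case: k => //= k; rewrite uphalf_half => /negbTE ->.
  by apply: complex_eq; rewrite ?ReM ?ImM /=; ring.
by apply: complex_eq; rewrite ?ReM ?ImM /=; ring.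
Qed.

Lemma cis_csum t : has_csum (fun k => icoef k * ((t ^+ k)%:C)%C) (cis t).
Proof.
have E k : icoef k * ((t ^+ k)%:C)%C = (cos_coeff t k +i* sin_coeff t k)%C.
  rewrite /icoef exprIC natrC -fmorphV/=.
  have e (a1 a2 x y : R) : (a1 +i* a2)%C * (x%:C)%C * (y%:C)%C =
      (a1 * y * x +i* (a2 * y * x))%C.
    by apply: complex_eq; rewrite ?ReM ?ImM/= ?ReM ?ImM/=; ring.
  by rewrite e.
rewrite /cis; split; rewrite [X in _ --> X]/= ?cos.unlock ?sin.unlock.
- rewrite (_ : (fun n => _) = series (cos_coeff t)).
    exact: is_cvg_series_cos_coeff.
  by apply/funext => n; rewrite Re_sum; apply: eq_bigr => k _; rewrite E.
- rewrite (_ : (fun n => _) = series (sin_coeff t)).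
    exact: is_cvg_series_sin_coeff.
  by apply/funext => n; rewrite Im_sum; apply: eq_bigr => k _; rewrite E.
Qed.

(** Without its terms k = 0 and k = 1 the series of [cis t] has terms of norm |t|^k / k!, which sum
    to the right-hand side. *)
Lemma cis_approx1 t : normc (cis t - 1 - 'i%C * (t%:C)%C) <= expR `|t| - 1 - `|t|.
Proof.
have h := has_csumB (has_csumB (cis_csum t) (has_csum_single 0%N 1))
  (has_csum_single 1%N ('i%C * (t%:C)%C)).
pose y k : R := `|t| ^+ k / k`!%:R - (if k == 0%N then 1 else 0) - (if k == 1%N then `|t| else 0).
have y0 : series y @ \oo --> expR `|t| - 1 - `|t|.
  have hy : series (exp_coeff `|t|) @ \oo --> expR `|t|.
    exact: is_cvg_series_exp_coeff.
  have : series (exp_coeff `|t|) n - 1 - `|t| @[n --> \oo] --> expR `|t| - 1 - `|t|.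
    by apply: cvgB; [apply: cvgB => //|]; exact: cvg_cst.
  apply: cvg_trans; apply: near_eq_cvg; near=> n.
  rewrite /series/= /y !sumrB; congr (_ - _ - _).
    by rewrite -big_mkcond/= big_nat1_eq ifT//; near: n; exists 1%N.
  rewrite -big_mkcond/= big_nat1_eq ifT//.
  by near: n; exists 2%N.
apply: (has_csum_normc h _ y0) => k; rewrite /y.
have [->|k0] := eqVneq k 0%N.
  rewrite (_ : 0%N == 1%N = false)// icoef0 !expr0 divr1 mulr1.
  by rewrite !subr0 !subrr normc0.
have [->|k1] := eqVneq k 1%N.
  by rewrite icoef1 !expr1 divr1 !subr0 !subrr normc0.
by rewrite !subr0 normcM normc_icoef normc_real normrX mulrC.
Unshelve. all: by end_near. Qed.

(** From e^(-t) >= 1 - t one gets e^t (1 - t) <= 1, and 1 is at most (1 + t + 2 t^2)(1 - t) = 1 +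
    t^2 (1 - 2 t) when t <= 1/2. *)
Lemma expR_approx1 t : `|t| <= 2^-1 -> 0 <= expR t - 1 - t <= 2 * t ^+ 2.
Proof.
move=> t2; have t1 : t < 1 by move: t2; rewrite ler_norml => /andP[_ ?]; lra.
rewrite -addrA -opprD subr_ge0 expR_ge1Dx/= -[leRHS]addr0.
have h : expR t * (1 - t) <= 1.
  rewrite -[leRHS](expR0) -(subrr t) expRD ler_wpM2l ?expR_ge0//.
  exact: expR_ge1Dx.
have : expR t * (1 - t) <= (1 + t + 2 * t ^+ 2) * (1 - t).
  apply: (le_trans h); move: t2; rewrite ler_norml => /andP[_ t2].
  have -> : (1 + t + 2 * t ^+ 2) * (1 - t) = 1 + t ^+ 2 * (1 - 2 * t) by ring.
  by rewrite lerDl mulr_ge0 ?sqr_ge0//; lra.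
by rewrite ler_pM2r ?subr_gt0//; lra.
Qed.

Lemma cexp_approx1 z : normc z <= 2^-1 -> normc (cexp z - 1 - z) <= 10 * normc z ^+ 2.
Proof.
move=> z2; set r := normc z.
pose x := complex.Re z; pose y := complex.Im z.
have xr : `|x| <= r by exact: Re_le_normc.
have yr : `|y| <= r by exact: Im_le_normc.
have r0 : 0 <= r by exact: normc_ge0.
have x2 : `|x| <= 2^-1 by exact: le_trans z2.
have y2 : `| `|y| | <= 2^-1 by rewrite normr_id; exact: le_trans z2.
have sq (a : R) : `|a| <= r -> a ^+ 2 <= r ^+ 2.
  by move=> ar; rewrite -[a ^+ 2]ger0_norm ?sqr_ge0// normrX lerXn2r ?nnegrE.
have /andP[e0 e1] := expR_approx1 x2; have /andP[_ f1] := expR_approx1 y2.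
(* The three terms are bounded by 2 r^2, 4 r^2 and 2 r^2, which leaves room in the constant 10. *)
have -> : cexp z - 1 - z = ((expR x - 1 - x)%:C)%C
   + ((expR x)%:C)%C * (cis y - 1 - 'i%C * (y%:C)%C)
   + ((expR x - 1)%:C)%C * ('i%C * (y%:C)%C).
  rewrite cexpE [in - z](complexE z) -/x -/y !rmorphB/= rmorph1; ring.
apply: le_trans (le_normcD _ _) _.
apply: le_trans (lerD (le_normcD _ _) (lexx _)) _.
rewrite !normcM !normc_real (ger0_norm e0) (ger0_norm (expR_ge0 _)).
have ni : normc ('i%C : R[i]) = 1 by rewrite /= expr0n expr1n add0r sqrtr1.
rewrite ni mul1r.
have hy : normc (cis y - 1 - 'i%C * (y%:C)%C) <= 2 * r ^+ 2.
  apply: le_trans (cis_approx1 y) _; apply: le_trans f1 _.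
  by rewrite ler_pM2l// sq// normr_id.
have ex : expR x <= 2.
  have := sq _ xr; move: e1 x2; rewrite ler_norml => e1 /andP[x3 x4] _.
  by nra.
have ex1 : `|expR x - 1| <= 2 * `|x|.
  have : `|expR x - 1 - x| <= `|x|.
    rewrite ger0_norm//; apply: (le_trans e1).
    rewrite -real_normK ?num_real// expr2 mulrA ler_piMl// -[leRHS](@mulfV _ (2 : R))//.
    by rewrite ler_pM2l.
  move=> h; rewrite -(subrK x (expR x - 1)) mulr_natl mulr2n.
  by apply: le_trans (ler_normD _ _) _; rewrite lerD2r.
have A1 : expR x * normc (cis y - 1 - 'i%C * (y%:C)%C) <= 2 * (2 * r ^+ 2).
  by rewrite ler_pM ?expR_ge0 ?normc_ge0.
have A2 : `|expR x - 1| * `|y| <= 2 * r * r.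
  by rewrite ler_pM// (le_trans ex1)// ler_pM2l.
have := sq _ xr; lra.
Qed.

End complex_analysis.

(** * Means of bounded functions and independence *)

Section bounded_measurable.
Context d (T : measurableType d) (R : realType).
Implicit Types f g : T -> R.

(** Unlike integrable functions, these are stable under products, and they are integrable for every
    probability. *)
Definition bounded_mfun f :=
  measurable_fun [set: T] f /\ exists M : R, forall w, `|f w| <= M.

Lemma bmf_cst (a : R) : bounded_mfun (fun=> a).
Proof. by split; [exact: measurable_cst|exists `|a|]. Qed.

Lemma bmfD f g : bounded_mfun f -> bounded_mfun g ->
  bounded_mfun (fun w => f w + g w).
Proof.
move=> [mf [M hM]] [mg [N hN]]; split; first exact: measurable_funD.
by exists (M + N) => w; apply: le_trans (ler_normD _ _) _; exact: lerD.
Qed.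

Lemma bmfM f g : bounded_mfun f -> bounded_mfun g ->
  bounded_mfun (fun w => f w * g w).
Proof.
move=> [mf [M hM]] [mg [N hN]]; split; first exact: measurable_funM.
by exists (M * N) => w; rewrite normrM ler_pM.
Qed.

Lemma bmfN f : bounded_mfun f -> bounded_mfun (fun w => - f w).
Proof.
move=> hf; have := bmfM (bmf_cst (-1)) hf.
by congr bounded_mfun; apply/funext => w; rewrite mulN1r.
Qed.

Lemma bmf_indic (A : set T) : measurable A -> bounded_mfun (\1_A : T -> R).
Proof.
move=> mA; split; first exact: measurable_indic.
by exists 1 => w; rewrite indicE; case: (w \in A); rewrite ?normr1 ?normr0.
Qed.

Lemma bmf_sum I (r : seq I) (f : I -> T -> R) :
  (forall i, bounded_mfun (f i)) -> bounded_mfun (fun w => \sum_(i <- r) f i w).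
Proof.
move=> hf; elim: r => [|i r IH].
  by under eq_fun do rewrite big_nil; exact: bmf_cst.
by under eq_fun do rewrite big_cons; exact: bmfD.
Qed.

Lemma bmf_integrable (P : probability T R) f : bounded_mfun f ->
  P.-integrable [set: T] (EFin \o f).
Proof.
move=> [mf [M hM]]; apply: measurable_bounded_integrable => //.
  by apply: le_lt_trans (probability_le1 P measurableT) _; exact: ltry.
exists M; split; first exact: num_real.
by move=> N MN w _ /=; apply: le_trans (hM w) _; exact: ltW.
Qed.

End bounded_measurable.

Lemma bmf_comp d (T : measurableType d) d' (U : measurableType d') (R : realType)
  (f : U -> R) (X : T -> U) : measurable_fun [set: T] X -> bounded_mfun f ->
  bounded_mfun (fun w => f (X w)).
Proof.
move=> mX [mf [M hM]]; split; first exact: measurableT_comp.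
by exists M => w; exact: hM.
Qed.

Section mean_theory.
Context d (T : measurableType d) (R : realType) (P : probability T R).
Implicit Types f g : T -> R.

Lemma meanE f : mean P f = \int[P]_w f w.
Proof. by rewrite /mean unlock. Qed.

Lemma mean_cst (a : R) : mean P (fun=> a) = a.
Proof. by rewrite /mean expectation_cst. Qed.

Lemma meanD f g : P.-integrable [set: T] (EFin \o f) ->
  P.-integrable [set: T] (EFin \o g) ->
  mean P (fun w => f w + g w) = mean P f + mean P g.
Proof. by move=> hf hg; rewrite !meanE RintegralD. Qed.

Lemma meanZl (a : R) f : P.-integrable [set: T] (EFin \o f) ->
  mean P (fun w => a * f w) = a * mean P f.
Proof. by move=> hf; rewrite !meanE RintegralZl. Qed.

Lemma le_mean f g : P.-integrable [set: T] (EFin \o f) ->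
  P.-integrable [set: T] (EFin \o g) -> (forall w, f w <= g w) ->
  mean P f <= mean P g.
Proof. by move=> hf hg fg; rewrite !meanE; apply: le_Rintegral. Qed.

Lemma mean_indic (A : set T) : measurable A -> mean P (\1_A) = fine (P A).
Proof. by move=> mA; rewrite /mean expectation_indic. Qed.

Lemma ae_eq_mean f g : measurable_fun [set: T] f -> measurable_fun [set: T] g ->
  {ae P, forall w, f w = g w} -> mean P f = mean P g.
Proof.
move=> mf mg fg; rewrite /mean unlock; congr fine.
apply: ae_eq_integral => //; [exact/measurable_EFinP|exact/measurable_EFinP|].
by apply: filterS fg => w /= -> _.
Qed.

Lemma mean_dominated_cvg (F : nat -> T -> R) f g :
  (forall n, measurable_fun [set: T] (F n)) -> measurable_fun [set: T] f ->
  P.-integrable [set: T] (EFin \o g) ->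
  {ae P, forall w, (fun n => F n w) @ \oo --> f w} ->
  (forall n w, `|F n w| <= g w) ->
  (fun n => mean P (F n)) @ \oo --> mean P f.
Proof.
move=> mF mf ig Ff Fg.
have [] := @dominated_convergence _ _ _ P _ measurableT (fun n w => (F n w)%:E)
  (EFin \o f) (EFin \o g).
- by move=> n; exact/measurable_EFinP.
- exact/measurable_EFinP.
- by apply: filterS Ff => w Ff _; apply/fine_cvgP; split; [exact: nearW|exact: Ff].
- exact: ig.
- by apply: aeW => w n _; rewrite lee_fin.
move=> i1 _ h; rewrite /mean unlock; apply: fine_cvg.
by rewrite fineK//; exact: integrable_fin_num.
Qed.

Lemma mean_bounded_cvg (F : nat -> T -> R) f (K : R) :
  (forall n, measurable_fun [set: T] (F n)) -> measurable_fun [set: T] f ->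
  {ae P, forall w, (fun n => F n w) @ \oo --> f w} ->
  (forall n w, `|F n w| <= K) ->
  (fun n => mean P (F n)) @ \oo --> mean P f.
Proof.
move=> mF mf Ff FK; apply: (@mean_dominated_cvg _ _ (fun=> K)) => //.
by apply: bmf_integrable; exact: bmf_cst.
Qed.

Lemma mean_sumZ I (r : seq I) (a : I -> R) (F : I -> T -> R) :
  (forall i, bounded_mfun (F i)) ->
  mean P (fun w => \sum_(i <- r) a i * F i w) = \sum_(i <- r) a i * mean P (F i).
Proof.
move=> hF; elim: r => [|i r IH].
  by under eq_fun do rewrite big_nil; rewrite mean_cst big_nil.
under eq_fun do rewrite big_cons.
have hZ j : bounded_mfun (fun w => a j * F j w) by apply: bmfM => //; exact: bmf_cst.
rewrite meanD ?big_cons ?IH ?meanZl//; apply: bmf_integrable => //.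
exact: bmf_sum.
Qed.

Import HBNNSimple.

(* Approximate [f] from below by simple functions and pass to the limit by
   bounded convergence. *)
Lemma mean_transfer d' (U : measurableType d') (Z1 Z2 : T -> R) (X1 X2 : T -> U) :
  bounded_mfun Z1 -> bounded_mfun Z2 ->
  measurable_fun [set: T] X1 -> measurable_fun [set: T] X2 ->
  (forall B, measurable B -> mean P (fun w => Z1 w * \1_B (X1 w)) =
                             mean P (fun w => Z2 w * \1_B (X2 w))) ->
  forall f : U -> R, bounded_mfun f ->
  mean P (fun w => Z1 w * f (X1 w)) = mean P (fun w => Z2 w * f (X2 w)).
Proof.
move=> bZ1 bZ2 mX1 mX2 H f bf.
(* Adding a bound M makes [f] nonnegative; the correction is M times the hypothesis for the full
   set. *)
wlog f0 : f bf / forall x, 0 <= f x.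
  move=> W; have [_ [M hM]] := bf.
  have bM : bounded_mfun (fun x => f x + M) by apply: bmfD => //; exact: bmf_cst.
  have M0 x : 0 <= f x + M.
    by have := hM x; rewrite ler_norml => /andP[]; rewrite -subr_ge0 opprK.
  have E Z X : bounded_mfun Z -> measurable_fun [set: T] X ->
      mean P (fun w => Z w * f (X w)) = mean P (fun w => Z w * (f (X w) + M))
        - M * mean P (fun w => Z w * \1_[set: U] (X w)).
    move=> bZ mX; rewrite -mulNr -meanZl -?meanD; last first.
    - by apply: bmf_integrable; apply: bmfM => //; apply: bmf_comp => //; exact: bmf_indic.
    - by apply: bmf_integrable; apply: bmfM; [exact: bmf_cst|];
        apply: bmfM => //; apply: bmf_comp => //; exact: bmf_indic.
    - by apply: bmf_integrable; apply: bmfM => //; apply: (bmf_comp mX bM).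
    congr mean; apply/funext => w; rewrite indicE in_setT mulr1; ring.
  by rewrite (E _ _ bZ1 mX1) (E _ _ bZ2 mX2) (W _ bM M0) H.
have [mf [M hM]] := bf.
have mfE : measurable_fun [set: U] (EFin \o f) by exact/measurable_EFinP.
pose g n := nnsfun_approx measurableT mfE n.
have g_f x : (fun n => g n x) @ \oo --> f x.
  apply: (@fine_cvg _ _ _ _ (fun n => (g n x)%:E)).
  by apply: (@cvg_nnsfun_approx _ _ _ setT measurableT (EFin \o f) mfE) => // y _; rewrite lee_fin.
have g_le n x : g n x <= f x.
  rewrite -lee_fin /g nnsfun_approxE.
  by apply: le_approx => // y _; rewrite lee_fin.
have g_bound n x : `|g n x| <= M.
  by rewrite ger0_norm// (le_trans (g_le _ _))// (le_trans (ler_norm _)).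
have bg n : bounded_mfun (g n) by split => //; exists M.
have gmean n : mean P (fun w => Z1 w * g n (X1 w)) = mean P (fun w => Z2 w * g n (X2 w)).
  have E Z X : bounded_mfun Z -> measurable_fun [set: T] X ->
      mean P (fun w => Z w * g n (X w)) =
      \sum_(y <- finmap.enum_fset (fset_set (range (g n))))
        y * mean P (fun w => Z w * \1_(g n @^-1` [set y]) (X w)).
    move=> bZ mX; rewrite -mean_sumZ; last first.
      move=> y; apply: bmfM => //; apply: bmf_comp => //; apply: bmf_indic.
      exact: measurable_sfunP.
    congr mean; apply/funext => w; rewrite {1}(fimfunE (g n)) fsbig_finite//=.
    by rewrite mulr_sumr; apply: eq_bigr => y _; rewrite mulrCA.
  rewrite (E _ _ bZ1 mX1) (E _ _ bZ2 mX2); apply: eq_bigr => y _.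
  by rewrite H//; exact: measurable_sfunP.
have lim Z X : bounded_mfun Z -> measurable_fun [set: T] X ->
    (fun n => mean P (fun w => Z w * g n (X w))) @ \oo -->
    mean P (fun w => Z w * f (X w)).
  move=> bZ mX; have [mZ [K hK]] := bZ.
  apply: (@mean_bounded_cvg _ _ (K * M)).
  - by move=> n; have [] := bmfM bZ (bmf_comp mX (bg n)).
  - by have [] := bmfM bZ (bmf_comp mX bf).
  - by apply: aeW => w; apply: cvgM; [exact: cvg_cst|exact: g_f].
  - by move=> n w; rewrite normrM ler_pM.
have := lim _ _ bZ1 mX1; under eq_fun do rewrite gmean.
by move=> h; apply: cvg_unique h (lim _ _ bZ2 mX2).
Qed.

End mean_theory.

Section bounded_measurable_complex.
Context d (T : measurableType d) (R : realType).
Implicit Types Z : T -> R[i].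

Definition bounded_cmfun Z :=
  bounded_mfun (fun w => complex.Re (Z w)) /\
  bounded_mfun (fun w => complex.Im (Z w)).

Lemma bcmf_cst (a : R[i]) : bounded_cmfun (fun=> a).
Proof. by split; exact: bmf_cst. Qed.

Lemma bcmf_real (f : T -> R) : bounded_mfun f ->
  bounded_cmfun (fun w => ((f w)%:C)%C).
Proof. by move=> bf; split => //=; exact: bmf_cst. Qed.

Lemma bcmfD Z1 Z2 : bounded_cmfun Z1 -> bounded_cmfun Z2 ->
  bounded_cmfun (fun w => Z1 w + Z2 w).
Proof.
move=> [r1 i1] [r2 i2]; split.
- by under eq_fun do rewrite ReD; exact: bmfD.
- by under eq_fun do rewrite ImD; exact: bmfD.
Qed.

Lemma bcmfM Z1 Z2 : bounded_cmfun Z1 -> bounded_cmfun Z2 ->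
  bounded_cmfun (fun w => Z1 w * Z2 w).
Proof.
move=> [r1 i1] [r2 i2]; split.
- under eq_fun do rewrite ReM; apply: bmfD; first exact: bmfM.
  by apply: bmfN; exact: bmfM.
- by under eq_fun do rewrite ImM; apply: bmfD; exact: bmfM.
Qed.

Lemma bcmf_sum I (r : seq I) (F : I -> T -> R[i]) :
  (forall i, bounded_cmfun (F i)) -> bounded_cmfun (fun w => \sum_(i <- r) F i w).
Proof.
move=> h; elim: r => [|i r IH].
  by under eq_fun do rewrite big_nil; exact: bcmf_cst.
by under eq_fun do rewrite big_cons; exact: bcmfD.
Qed.

Lemma bcmf_prod I (r : seq I) (F : I -> T -> R[i]) :
  (forall i, bounded_cmfun (F i)) -> bounded_cmfun (fun w => \prod_(i <- r) F i w).
Proof.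
move=> h; elim: r => [|i r IH].
  by under eq_fun do rewrite big_nil; exact: bcmf_cst.
by under eq_fun do rewrite big_cons; exact: bcmfM.
Qed.

Lemma bcmf_cis (f : T -> R) : measurable_fun [set: T] f ->
  bounded_cmfun (fun w => cis (f w)).
Proof.
move=> mf; split => /=; split.
- apply: measurableT_comp mf; apply: continuous_measurable_fun.
  exact: continuous_cos.
- by exists 1 => w; exact: cos_max.
- apply: measurableT_comp mf; apply: continuous_measurable_fun.
  exact: continuous_sin.
- by exists 1 => w; exact: sin_max.
Qed.

End bounded_measurable_complex.

Lemma bcmf_comp d (T : measurableType d) d' (U : measurableType d') (R : realType)
  (f : U -> R[i]) (X : T -> U) : measurable_fun [set: T] X -> bounded_cmfun f ->
  bounded_cmfun (fun w => f (X w)).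
Proof.
by move=> mX [fr fi]; split;
  [exact: (bmf_comp mX fr)|exact: (bmf_comp mX fi)].
Qed.

(** * Complex means and their factorisation under independence *)

Section complex_mean.
Context d (T : measurableType d) (R : realType) (P : probability T R).
Implicit Types Z : T -> R[i].

(** [charfun P X s] is convertible with the [Cmean] of [cis (s * X w)]. *)
Definition Cmean Z : R[i] :=
  (mean P (fun w => complex.Re (Z w)) +i* mean P (fun w => complex.Im (Z w)))%C.

Lemma Cmean_cst (a : R[i]) : Cmean (fun=> a) = a.
Proof. by rewrite /Cmean !mean_cst; case: a. Qed.

Lemma CmeanD Z1 Z2 : bounded_cmfun Z1 -> bounded_cmfun Z2 ->
  Cmean (fun w => Z1 w + Z2 w) = Cmean Z1 + Cmean Z2.
Proof.
move=> [r1 i1] [r2 i2]; apply: complex_eq; rewrite ?ReD ?ImD /=.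
- by under eq_fun do rewrite ReD; rewrite meanD//; exact: bmf_integrable.
- by under eq_fun do rewrite ImD; rewrite meanD//; exact: bmf_integrable.
Qed.

Lemma CmeanZl (a : R[i]) Z : bounded_cmfun Z ->
  Cmean (fun w => a * Z w) = a * Cmean Z.
Proof.
move=> [r1 i1]; apply: complex_eq; rewrite ?ReM ?ImM /=.
- under eq_fun do rewrite ReM -mulNr; rewrite meanD ?meanZl ?mulNr//;
    apply: bmf_integrable => //; apply: bmfM => //; exact: bmf_cst.
- under eq_fun do rewrite ImM; rewrite meanD ?meanZl//;
    apply: bmf_integrable => //; apply: bmfM => //; exact: bmf_cst.
Qed.

Lemma Cmean_sum I (r : seq I) (F : I -> T -> R[i]) :
  (forall i, bounded_cmfun (F i)) ->
  Cmean (fun w => \sum_(i <- r) F i w) = \sum_(i <- r) Cmean (F i).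
Proof.
move=> h; elim: r => [|i r IH].
  by under eq_fun do rewrite big_nil; rewrite Cmean_cst big_nil.
under eq_fun do rewrite big_cons; rewrite CmeanD//; last exact: bcmf_sum.
by rewrite big_cons IH.
Qed.

(* With [z] the mean of [Z], [|z|^2] is the mean of the real part of [conj z * Z]. *)
Lemma normc_Cmean Z (y : T -> R) : bounded_cmfun Z -> bounded_mfun y ->
  {ae P, forall w, normc (Z w) <= y w} -> normc (Cmean Z) <= mean P y.
Proof.
move=> bZ bY Zy; set z := Cmean Z.
have y0 : 0 <= mean P y.
  (* The hypothesis makes [y] nonnegative only almost everywhere, while [le_mean] asks for a
     pointwise inequality. *)
  pose y' w : R := `|y w|.
  have by' : bounded_mfun y'.
    have [my [M hM]] := bY; split; first exact: measurableT_comp.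
    by exists M => w; rewrite normr_id.
  rewrite (_ : mean P y = mean P y').
    rewrite -[leLHS](mean_cst P 0); apply: le_mean; try exact: bmf_integrable.
      by apply: bmf_integrable; exact: bmf_cst.
    by move=> w; exact: normr_ge0.
  apply: ae_eq_mean; [exact: bY.1|exact: by'.1|].
  by apply: filterS Zy => w Zy; rewrite /y' ger0_norm// (le_trans _ Zy)// normc_ge0.
have [z0|z0] := eqVneq (normc z) 0; first by rewrite z0.
have zp : 0 < normc z by rewrite lt_neqAle eq_sym z0 normc_ge0.
rewrite -(ler_pM2l zp) -meanZl; last exact: bmf_integrable.
have bzZ : bounded_cmfun (fun w => z^*%C * Z w) by apply: bcmfM => //; exact: bcmf_cst.
have -> : normc z * normc z = mean P (fun w => complex.Re (z^*%C * Z w)).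
  rewrite -[RHS]/(complex.Re (Cmean _)) CmeanZl// -/z; case: (z) => a b /=.
  by rewrite -expr2 sqr_sqrtr ?addr_ge0 ?sqr_ge0// mulNr opprK.
(* The maximum dominates the real part everywhere and agrees almost everywhere with |z| y. *)
pose g w := Num.max (complex.Re (z^*%C * Z w)) (normc z * y w).
have bzy : bounded_mfun (fun w => normc z * y w) by apply: bmfM => //; exact: bmf_cst.
have bg : bounded_mfun g.
  have [[m1 [M1 h1]] _] := bzZ; have [m2 [M2 h2]] := bzy.
  split; first exact: measurable_maxr.
  exists (Num.max M1 M2) => w; rewrite /g.
  by case: (leP (complex.Re _)) => _; rewrite le_max ?h1 ?h2 ?orbT.
rewrite (_ : mean P (fun w => normc z * y w) = mean P g).
  apply: le_mean; [exact: bmf_integrable bzZ.1|exact: bmf_integrable|].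
  by move=> w; rewrite /g le_max lexx.
apply: ae_eq_mean; [exact: bzy.1|exact: bg.1|].
apply: filterS Zy => w Zy; rewrite /g max_r//.
apply: le_trans (ler_norm _) _; apply: le_trans (Re_le_normc _) _.
rewrite normcM (_ : normc z^*%C = normc z); last by case: (z) => a b /=; rewrite sqrrN.
by rewrite ler_pM2l.
Qed.

Lemma Cmean_bounded_cvg (F : nat -> T -> R[i]) Z (K : R) :
  (forall n, bounded_cmfun (F n)) -> bounded_cmfun Z ->
  {ae P, forall w, ccvg (fun n => F n w) (Z w)} ->
  (forall n w, normc (F n w) <= K) ->
  ccvg (fun n => Cmean (F n)) (Cmean Z).
Proof.
move=> bF [[mr _] [mi _]] FZ FK; split => /=.
- apply: (@mean_bounded_cvg _ _ _ _ _ _ K) => //.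
  + by move=> n; have [[]] := bF n.
  + by apply: filterS FZ => w [].
  + by move=> n w; apply: le_trans (FK n w); exact: Re_le_normc.
- apply: (@mean_bounded_cvg _ _ _ _ _ _ K) => //.
  + by move=> n; have [_ []] := bF n.
  + by apply: filterS FZ => w [].
  + by move=> n w; apply: le_trans (FK n w); exact: Im_le_normc.
Qed.

(** Indicators are real, so the hypothesis splits into one for real parts and one for imaginary
    parts; [mean_transfer] then treats the four real products in Z f(X). *)
Lemma Cmean_transfer d' (U : measurableType d') (Z1 Z2 : T -> R[i]) (X1 X2 : T -> U) :
  bounded_cmfun Z1 -> bounded_cmfun Z2 ->
  measurable_fun [set: T] X1 -> measurable_fun [set: T] X2 ->
  (forall B, measurable B -> Cmean (fun w => Z1 w * ((\1_B (X1 w))%:C)%C) =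
                             Cmean (fun w => Z2 w * ((\1_B (X2 w))%:C)%C)) ->
  forall f : U -> R[i], bounded_cmfun f ->
  Cmean (fun w => Z1 w * f (X1 w)) = Cmean (fun w => Z2 w * f (X2 w)).
Proof.
move=> [r1 i1] [r2 i2] mX1 mX2 H f [fr fi].
have Hr B : measurable B -> mean P (fun w => complex.Re (Z1 w) * \1_B (X1 w)) =
    mean P (fun w => complex.Re (Z2 w) * \1_B (X2 w)).
  move=> /H /(congr1 (@complex.Re R)) /=.
  under eq_fun do rewrite ReM /= mulr0 subr0.
  by under [in X in _ = X -> _]eq_fun do rewrite ReM /= mulr0 subr0.
have Hi B : measurable B -> mean P (fun w => complex.Im (Z1 w) * \1_B (X1 w)) =
    mean P (fun w => complex.Im (Z2 w) * \1_B (X2 w)).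
  move=> /H /(congr1 (@complex.Im R)) /=.
  under eq_fun do rewrite ImM /= mulr0 add0r.
  by under [in X in _ = X -> _]eq_fun do rewrite ImM /= mulr0 add0r.
have E Z X : bounded_mfun (fun w => complex.Re (Z w)) ->
    bounded_mfun (fun w => complex.Im (Z w)) -> measurable_fun [set: T] X ->
    Cmean (fun w => Z w * f (X w)) =
    ((mean P (fun w => complex.Re (Z w) * complex.Re (f (X w))) -
     mean P (fun w => complex.Im (Z w) * complex.Im (f (X w)))) +i*
     (mean P (fun w => complex.Re (Z w) * complex.Im (f (X w))) +
      mean P (fun w => complex.Im (Z w) * complex.Re (f (X w)))))%C.
  move=> bR bI mX.
  have br := bmf_comp mX fr; have bi := bmf_comp mX fi.
  apply: complex_eq => /=.
  - under eq_fun do rewrite ReM -mulN1r; rewrite meanD ?meanZl ?mulN1r//;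
      apply: bmf_integrable; try exact: bmfM.
    by apply: bmfM; [exact: bmf_cst|exact: bmfM].
  - by under eq_fun do rewrite ImM; rewrite meanD//; apply: bmf_integrable; exact: bmfM.
rewrite (E _ _ r1 i1 mX1) (E _ _ r2 i2 mX2).
congr ((_ - _) +i* (_ + _))%C.
- exact: (mean_transfer r1 r2 mX1 mX2 Hr fr).
- exact: (mean_transfer i1 i2 mX1 mX2 Hi fi).
- exact: (mean_transfer r1 r2 mX1 mX2 Hr fi).
- exact: (mean_transfer i1 i2 mX1 mX2 Hi fr).
Qed.

Lemma Cmean_real (f : T -> R) : Cmean (fun w => ((f w)%:C)%C) = ((mean P f)%:C)%C.
Proof. by rewrite /Cmean /= mean_cst. Qed.

Lemma Cmean_identically_distributed d' (U : measurableType d') (X1 X2 : T -> U) :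
  measurable_fun [set: T] X1 -> measurable_fun [set: T] X2 ->
  (forall B, measurable B -> P (X1 @^-1` B) = P (X2 @^-1` B)) ->
  forall f : U -> R[i], bounded_cmfun f ->
  Cmean (fun w => f (X1 w)) = Cmean (fun w => f (X2 w)).
Proof.
move=> mX1 mX2 H f bf.
have := @Cmean_transfer _ _ (fun=> 1) (fun=> 1) X1 X2 (bcmf_cst _ _) (bcmf_cst _ _)
  mX1 mX2 _ f bf.
under eq_fun do rewrite mul1r.
under [in X in (_ -> _ = X) -> _]eq_fun do rewrite mul1r.
apply=> B mB.
have E X : measurable_fun [set: T] X -> Cmean (fun w => 1 * ((\1_B (X w))%:C)%C) =
    ((fine (P (X @^-1` B)))%:C)%C.
  move=> mX; under eq_fun do rewrite mul1r; rewrite Cmean_real -mean_indic//.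
  by rewrite -[X @^-1` B]setTI; exact: mX.
by rewrite !E// H.
Qed.

(** Induction on [J]: the indicator at the head is replaced by [f i] through [Cmean_transfer], then
    [f i (X i w)] is absorbed into [Z] and its mean into [a]. This is why [Z] and [a] are
    arbitrary. *)
Lemma Cmean_indep_prod d' (U : measurableType d') (I : eqType) (J : seq I)
    (X : I -> T -> U) Z (a : R[i]) :
  uniq J -> (forall i, measurable_fun [set: T] (X i)) -> bounded_cmfun Z ->
  (forall B : I -> set U, (forall i, measurable (B i)) ->
    Cmean (fun w => Z w * \prod_(i <- J) ((\1_(B i) (X i w))%:C)%C) =
    a * \prod_(i <- J) ((fine (P (X i @^-1` B i)))%:C)%C) ->
  forall f : I -> U -> R[i], (forall i, bounded_cmfun (f i)) ->
    Cmean (fun w => Z w * \prod_(i <- J) f i (X i w)) =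
    a * \prod_(i <- J) Cmean (fun w => f i (X i w)).
Proof.
move=> + mX + + f bf; elim: J Z a => [|i J IH] Z a.
  move=> _ bZ H; have := H (fun=> set0) (fun=> measurable0).
  under eq_fun do rewrite big_nil; rewrite !big_nil => <-.
  by under eq_fun do rewrite big_nil.
move=> /= /andP[iJ uJ] bZ H.
have bI (B : set U) j : measurable B ->
    bounded_cmfun (fun w => ((\1_B (X j w))%:C)%C : R[i]).
  by move=> mB; apply: bcmf_real; apply: (bmf_comp (mX j)); exact: bmf_indic.
have bfX j : bounded_cmfun (fun w => f j (X j w)) by exact: bcmf_comp.
under eq_fun do rewrite big_cons mulrA.
rewrite big_cons mulrA; apply: IH => //; first exact: bcmfM.
move=> B mB; pose Q w := \prod_(j <- J) ((\1_(B j) (X j w))%:C)%C : R[i].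
have bQ : bounded_cmfun Q by apply: bcmf_prod => j; exact: bI.
pose q : R[i] := \prod_(j <- J) ((fine (P (X j @^-1` B j)))%:C)%C.
rewrite -/q.
have := @Cmean_transfer _ _ (fun w => Z w * Q w) (fun=> a * q) (X i) (X i)
   (bcmfM bZ bQ) (bcmf_cst _ _) (mX i) (mX i) _ (f i) (bf i).
have -> : (fun w => Z w * Q w * f i (X i w)) = (fun w => Z w * f i (X i w) * Q w).
  by apply/funext => w; rewrite mulrAC.
move=> ->; first by rewrite CmeanZl// mulrAC.
(* [H] is applied to the box with side [C] at [i]; as [i] does not occur in [J], the other sides are
   unchanged. *)
move=> C mC; pose B' j := if j == i then C else B j.
have mB' j : measurable (B' j) by rewrite /B'; case: ifP.
have B'J j : j \in J -> B' j = B j.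
  by move=> jJ; rewrite /B'; case: eqP => // ji; move: iJ; rewrite -ji jJ.
have B'i : B' i = C by rewrite /B' eqxx.
have := H B' mB'; rewrite big_cons B'i.
under eq_fun do rewrite big_cons B'i.
have -> : \prod_(j <- J) ((fine (P (X j @^-1` B' j)))%:C)%C = q.
  by apply: eq_big_seq => j jJ; rewrite B'J.
have -> : (fun w => Z w * (((\1_C (X i w))%:C)%C *
    \prod_(j <- J) ((\1_(B' j) (X j w))%:C)%C)) =
    (fun w => Z w * Q w * ((\1_C (X i w))%:C)%C).
  apply/funext => w; rewrite -mulrA [Q w * _]mulrC; congr (_ * (_ * _)).
  by apply: eq_big_seq => j jJ; rewrite B'J.
move=> ->; rewrite CmeanZl; last exact: bI.
rewrite Cmean_real mean_indic; first by rewrite mulrCA mulrC.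
by have := mX i measurableT C mC; rewrite setTI.
Qed.

Lemma indic_prod (I : eqType) (J : seq I) (A : I -> set T) w :
  \prod_(i <- J) ((\1_(A i) w)%:C)%C =
  ((\1_(\big[setI/setT]_(i <- J) A i) w)%:C)%C :> R[i].
Proof.
elim: J => [|i J IH]; first by rewrite !big_nil indicT.
by rewrite !big_cons IH indicI rmorphM.
Qed.

Lemma bigsetI_measurable (I : eqType) (J : seq I) (A : I -> set T) :
  (forall i, measurable (A i)) -> measurable (\big[setI/setT]_(i <- J) A i).
Proof.
move=> mA; elim: J => [|i J IH]; first by rewrite big_nil.
by rewrite big_cons; exact: measurableI.
Qed.

(** Applied twice: with [A] a cylinder of the arrivals and [X] the marks, and with [A] the whole
    space and [X] the Poisson increments. *)
Lemma Cmean_indep_event d' (U : measurableType d') (I : eqType) (J : seq I)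
    (X : I -> T -> U) (A : set T) :
  uniq J -> (forall i, measurable_fun [set: T] (X i)) -> measurable A ->
  (forall B : I -> set U, (forall i, measurable (B i)) ->
    P (A `&` \big[setI/setT]_(i <- J) (X i @^-1` B i)) =
    (P A * \prod_(i <- J) P (X i @^-1` B i))%E) ->
  forall f : I -> U -> R[i], (forall i, bounded_cmfun (f i)) ->
    Cmean (fun w => ((\1_A w)%:C)%C * \prod_(i <- J) f i (X i w)) =
    ((fine (P A))%:C)%C * \prod_(i <- J) Cmean (fun w => f i (X i w)).
Proof.
move=> uJ mX mA H f bf.
apply: Cmean_indep_prod => //; first by apply: bcmf_real; exact: bmf_indic.
move=> B mB.
have mXB i : measurable (X i @^-1` B i) by rewrite -[_ @^-1` _]setTI; exact: mX.
have -> : (fun w => ((\1_A w)%:C)%C * \prod_(i <- J) ((\1_(B i) (X i w))%:C)%C) =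
    (fun w => ((\1_(A `&` \big[setI/setT]_(i <- J) (X i @^-1` B i)) w)%:C)%C : R[i]).
  apply/funext => w.
  transitivity (((\1_A w)%:C)%C *
    ((\1_(\big[setI/setT]_(i <- J) (X i @^-1` B i)) w)%:C)%C : R[i]).
    by rewrite -indic_prod.
  by rewrite indicI -rmorphM.
rewrite Cmean_real mean_indic; last first.
  by apply: measurableI => //; exact: bigsetI_measurable.
have fe : (\prod_(i <- J) P (X i @^-1` B i) =
    (\prod_(i <- J) fine (P (X i @^-1` B i)))%:E)%E.
  elim: (J) => [|i J' IH]; first by rewrite !big_nil.
  by rewrite !big_cons IH EFinM fineK// fin_num_measure.
rewrite H// fe -[in LHS](fineK (fin_num_measure P _ mA)) -EFinM/= rmorphM.
by rewrite rmorph_prod.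
Qed.

End complex_mean.

(** * Compound Poisson sums *)

Section independent_marks.
Context d (T : measurableType d) (R : realType) (P : probability T R).
Context d1 d2 (U1 : measurableType d1) (U2 : measurableType d2).
Variables (G : nat -> T -> U1) (W : nat -> T -> U2).
Hypothesis mG : forall j, measurable_fun [set: T] (G j).
Hypothesis mW : forall j, measurable_fun [set: T] (W j).
Hypothesis indW : mutually_independent P W.
Hypothesis eqW : forall j B, measurable B -> P (W j @^-1` B) = P (W 0%N @^-1` B).
Hypothesis indGW : independent_families P G W.
Variables (L : finType) (q : U1 -> L).
Hypothesis mq : forall l, measurable [set x | q x = l].

(** Assignments live on ['I_M] so that they form a finite type, while products run over naturals;
    [l0] is never reached for j < M. *)
Let ext M (l0 : L) (y : {ffun 'I_M -> L}) (j : nat) : L :=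
  if insub j is Some i then y i else l0.

(** Each factor is a sum over the possible types, of which one is nonzero; distributing the product
    over these sums gives one term per assignment. *)
Let expand M l0 (x : nat -> U1) (g : L -> nat -> R[i]) :
  \prod_(0 <= j < M) g (q (x j)) j =
  \sum_(y : {ffun 'I_M -> L})
    (\prod_(0 <= j < M) ((\1_[set x | q x = ext l0 y j] (x j))%:C)%C) *
    \prod_(0 <= j < M) g (ext l0 y j) j.
Proof.
have E j : g (q (x j)) j = \sum_l ((\1_[set x | q x = l] (x j))%:C)%C * g l j.
  rewrite (bigD1 (q (x j)))//= indicE mem_set// mul1r big1 ?addr0// => l lq.
  by rewrite indicE memNset ?mul0r//= => /esym/eqP; rewrite (negbTE lq).
under eq_bigr do rewrite E.
rewrite big_mkord bigA_distr_bigA/=; apply: eq_bigr => y _.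
rewrite !big_mkord -big_split/=; apply: eq_bigr => i _.
by rewrite /ext valK.
Qed.

(* Expand over the finitely many values of the marks' types, use independence
   term by term, and resum. *)
Lemma Cmean_marks (f : L -> U2 -> R[i]) M : (forall l, bounded_cmfun (f l)) ->
  Cmean P (fun w => \prod_(0 <= j < M) f (q (G j w)) (W j w)) =
  Cmean P (fun w => \prod_(0 <= j < M)
     Cmean P (fun w' => f (q (G j w)) (W 0%N w'))).
Proof.
move=> bf; pose l0 := q (G 0%N point).
pose A (y : {ffun 'I_M -> L}) :=
  \big[setI/setT]_(0 <= j < M) (G j @^-1` [set x | q x = ext l0 y j]).
have mA y : measurable (A y).
  apply: bigsetI_measurable => j.
  by rewrite -[_ @^-1` _]setTI; exact: mG.
have bA y : bounded_cmfun (fun w => ((\1_(A y) w)%:C)%C : R[i]).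
  by apply: bcmf_real; exact: bmf_indic.
pose psi l := Cmean P (fun w' => f l (W 0%N w')).
have EA y w : \prod_(0 <= j < M) ((\1_[set x | q x = ext l0 y j] (G j w))%:C)%C
    = ((\1_(A y) w)%:C)%C :> R[i].
  by rewrite /A -indic_prod.
transitivity (\sum_(y : {ffun 'I_M -> L}) ((fine (P (A y)))%:C)%C *
    \prod_(0 <= j < M) psi (ext l0 y j)).
  under eq_fun do rewrite (expand _ l0 (fun j => G j _) (fun l j => f l (W j _))).
  under eq_fun do under eq_bigr do rewrite EA.
  rewrite Cmean_sum; last first.
    move=> y; apply: bcmfM => //; apply: bcmf_prod => j.
    exact: (bcmf_comp (mW j)).
  apply: eq_bigr => y _.
  rewrite (@Cmean_indep_event _ _ _ P _ _ _ (index_iota 0 M) W (A y) _ mW (mA y)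
    _ (fun j => f (ext l0 y j)))//.
  - congr (_ * _); apply: eq_bigr => j _; rewrite /psi.
    by rewrite (@Cmean_identically_distributed _ _ _ _ _ _ _ (W 0%N))// => B mB; exact: eqW.
  - exact: iota_uniq.
  - move=> B mB; rewrite indGW//; congr (_ * _)%E.
    by apply: indW => //; exact: iota_uniq.
symmetry; under eq_fun do rewrite (expand _ l0 (fun j => G j _) (fun l _ => psi l)).
under eq_fun do under eq_bigr do rewrite EA mulrC.
rewrite Cmean_sum; last by move=> y; apply: bcmfM => //; exact: bcmf_cst.
apply: eq_bigr => y _.
by rewrite CmeanZl// Cmean_real mean_indic// mulrC.
Qed.

End independent_marks.

Lemma measurable_subn d (T : measurableType d) (X Y : T -> nat) :
  measurable_fun [set: T] X -> measurable_fun [set: T] Y ->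
  measurable_fun [set: T] (fun w => X w - Y w)%N.
Proof.
move=> mX mY _ B mB; rewrite setTI.
have -> : (fun w => X w - Y w)%N @^-1` B =
  \bigcup_a \bigcup_b (if (a - b)%N \in B then X @^-1` [set a] `&` Y @^-1` [set b]
    else set0).
  apply/seteqP; split => [w /= Bw|w /= [a _ [b _]]].
    by exists (X w) => //; exists (Y w) => //; rewrite mem_set.
  by case: ifPn => // /set_mem Bab [/= -> ->].
apply: bigcupT_measurable => a; apply: bigcupT_measurable => b.
case: ifP => // _; apply: measurableI.
  by have := mX measurableT [set a]; rewrite setTI; exact.
by have := mY measurableT [set b]; rewrite setTI; exact.
Qed.

Lemma bcmf_exprn (R : realType) (z : R[i]) : normc z <= 1 ->
  bounded_cmfun (fun k : nat => z ^+ k).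
Proof.
move=> z1; have h k : normc (z ^+ k) <= 1 by rewrite normcX exprn_ile1 ?normc_ge0.
by split; split => //; exists 1 => k; apply: le_trans (h k);
  [exact: Re_le_normc|exact: Im_le_normc].
Qed.

Lemma normc_Cmean_le1 d (T : measurableType d) (R : realType) (P : probability T R)
  (Z : T -> R[i]) : bounded_cmfun Z -> (forall w, normc (Z w) <= 1) ->
  normc (Cmean P Z) <= 1.
Proof.
move=> bZ Z1; rewrite -[leRHS](mean_cst P 1); apply: normc_Cmean => //.
  exact: bmf_cst.
exact: aeW.
Qed.

(** Only the values 0 and 1 of [Y] count at first order. Dropping the others costs P(Y >= 2) = 1 -
    (1 + h) e^(-h) <= h^2, and replacing 1 + h z by e^(h z) costs 10 h^2, whence 11. *)
Lemma Cmean_poisson_approx d (T : measurableType d) (R : realType)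
    (P : probability T R) (Y : T -> nat) (h : R) (z : R[i]) :
  measurable_fun [set: T] Y -> 0 < h -> h <= 2^-1 ->
  (forall k, P [set w | Y w = k] = (poisson_pmf h k)%:E) -> normc z <= 1 ->
  normc (Cmean P (fun w => z ^+ Y w) - cexp ((h%:C)%C * (z - 1))) <= 11 * h ^+ 2.
Proof.
move=> mY h0 h2 PY z1.
have mYk k : measurable [set w | Y w = k].
  by have := mY measurableT [set k]; rewrite setTI; exact.
pose I k w : R := \1_[set w | Y w = k] w.
have bI k : bounded_mfun (I k) by exact: bmf_indic.
have bIc k : bounded_cmfun (fun w => ((I k w)%:C)%C) by exact: bcmf_real.
have mI k : mean P (I k) = poisson_pmf h k by rewrite /I mean_indic// PY.
have p0 : poisson_pmf h 0 = expR (- h).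
  by rewrite /poisson_pmf h0 expr0 fact0 invr1 !mul1r.
have p1 : poisson_pmf h 1 = h * expR (- h).
  by rewrite /poisson_pmf h0 expr1 invr1 mulr1.
have e1 : 1 - h <= expR (- h) by exact: expR_ge1Dx.
have e2 : expR (- h) <= 1 by rewrite expR_le1; lra.
have bz : bounded_cmfun (fun w => z ^+ Y w) by exact: (bcmf_comp mY (bcmf_exprn z1)).
have bA : bounded_cmfun (fun w => (-1) * (((I 0%N w)%:C)%C + z * ((I 1%N w)%:C)%C)).
  by apply: bcmfM; [exact: bcmf_cst|apply: bcmfD => //; apply: bcmfM => //; exact: bcmf_cst].
have H1 : normc (Cmean P (fun w => z ^+ Y w) -
    ((expR (- h))%:C)%C * (1 + (h%:C)%C * z)) <= h ^+ 2.
  have -> : Cmean P (fun w => z ^+ Y w) - ((expR (- h))%:C)%C * (1 + (h%:C)%C * z) =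
      Cmean P (fun w => z ^+ Y w + (-1) * (((I 0%N w)%:C)%C + z * ((I 1%N w)%:C)%C)).
    rewrite CmeanD// CmeanZl; last first.
      by apply: bcmfD => //; apply: bcmfM => //; exact: bcmf_cst.
    rewrite CmeanD//; last by apply: bcmfM => //; exact: bcmf_cst.
    rewrite CmeanZl// !Cmean_real !mI p0 p1 rmorphM/=; ring.
  pose y w := 1 + -1 * (I 0%N w + I 1%N w).
  have bI01 : bounded_mfun (fun w => I 0%N w + I 1%N w) by exact: bmfD.
  have by' : bounded_mfun (fun w => -1 * (I 0%N w + I 1%N w)).
    by apply: bmfM => //; exact: bmf_cst.
  apply: (@le_trans _ _ (mean P y)).
    apply: normc_Cmean; [exact: bcmfD|by apply: bmfD => //; exact: bmf_cst|].
    apply: aeW => w; rewrite /y /I !indicE.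
    have EI k : (w \in [set w0 | Y w0 = k]) = (Y w == k).
      by apply/idP/eqP; rewrite inE.
    rewrite !EI; case: (eqVneq (Y w) 0%N) => [->|Y0].
      rewrite expr0 /=.
      rewrite (_ : 1 + -1 * (1 + z * 0) = 0 :> R[i]); first by rewrite normc0; lra.
      by ring.
    case: (eqVneq (Y w) 1%N) => [->|Y1].
      rewrite expr1 /=.
      rewrite (_ : z + -1 * (0 + z * 1) = 0 :> R[i]); first by rewrite normc0; lra.
      by ring.
    rewrite /= (_ : z ^+ Y w + -1 * (0 + z * 0) = z ^+ Y w); last by ring.
    rewrite addr0 mulr0 addr0 normcX.
    by rewrite exprn_ile1 ?normc_ge0.
  rewrite meanD ?mean_cst ?meanZl ?meanD ?mI; try exact: bmf_integrable.
    rewrite p0 p1.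
    have -> : 1 + -1 * (expR (- h) + h * expR (- h)) = 1 - (1 + h) * expR (- h) by ring.
    have : (1 + h) * (1 - h) <= (1 + h) * expR (- h) by rewrite ler_wpM2l//; lra.
    by move=> ?; lra.
  by apply: bmf_integrable; exact: bmf_cst.
have hz : normc ((h%:C)%C * z) <= h.
  by rewrite normcM normc_real gtr0_norm// ler_piMr// ltW.
have H2 : normc (((expR (- h))%:C)%C * (1 + (h%:C)%C * z) - cexp ((h%:C)%C * (z - 1)))
    <= 10 * h ^+ 2.
  have -> : cexp ((h%:C)%C * (z - 1)) = ((expR (- h))%:C)%C * cexp ((h%:C)%C * z).
    rewrite mulrBr mulr1 addrC cexpD; congr (_ * _).
    by rewrite cexpE /= oppr0 cis0 mulr1.
  rewrite -mulrBr normcM normc_real ger0_norm ?expR_ge0// normcB.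
  apply: le_trans (_ : normc (cexp ((h%:C)%C * z) - (1 + (h%:C)%C * z)) <= _).
    by rewrite ler_piMl ?normc_ge0.
  rewrite opprD addrA; apply: le_trans (cexp_approx1 _) _.
    exact: le_trans hz h2.
  rewrite ler_pM2l// lerXn2r ?nnegrE//; [exact: normc_ge0|exact: ltW].
set a := Cmean _ _; set b := ((expR (- h))%:C)%C * (1 + (h%:C)%C * z) in H1 H2.
have -> : a - cexp ((h%:C)%C * (z - 1)) = (a - b) + (b - cexp ((h%:C)%C * (z - 1))).
  by rewrite addrA subrK.
apply: le_trans (le_normcD _ _) _; apply: le_trans (lerD H1 H2) _; lra.
Qed.

(** * Increments of the Poisson process *)

Section poisson_increments.
Context d (T : measurableType d) (R : realType) (P : probability T R).
Variable N : R -> {RV P >-> nat}.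
Hypothesis hN : unit_poisson_process N.

Let incr (t : nat -> R) i w := (N (t i.+1) w - N (t i) w)%N.

Let mincr t i : measurable_fun [set: T] (incr t i).
Proof. by apply: measurable_subn; exact: measurable_funPT. Qed.

Lemma Cmean_prod_increments (t : nat -> R) (z : nat -> R[i]) n :
  0 <= t 0%N -> nondecreasing_seq t -> (forall i, normc (z i) <= 1) ->
  Cmean P (fun w => \prod_(0 <= i < n) z i ^+ (N (t i.+1) w - N (t i) w)%N) =
  \prod_(0 <= i < n) Cmean P (fun w => z i ^+ (N (t i.+1) w - N (t i) w)%N).
Proof.
move=> t0 nt z1; have [_ _ _ ind] := hN.
have := @Cmean_indep_event _ _ _ P _ _ _ (index_iota 0 n) (incr t) setT
  (iota_uniq _ _) (mincr t) measurableT _ (fun i k => z i ^+ k)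
  (fun i => bcmf_exprn (z1 i)).
rewrite probability_setT/= mul1r => <-.
  by congr Cmean; apply/funext => w; rewrite indicT mul1r.
move=> B mB; rewrite setTI mul1e.
exact: (ind t t0 nt (index_iota 0 n) B (iota_uniq _ _) mB).
Qed.

Lemma increments_approx (c h : R) (z : nat -> R[i]) n :
  0 <= c -> 0 < h -> h <= 2^-1 -> (forall i, normc (z i) <= 1) ->
  normc (Cmean P (fun w => \prod_(0 <= i < n)
      z i ^+ (N (c + i.+1%:R * h) w - N (c + i%:R * h) w)%N) -
    cexp ((h%:C)%C * \sum_(0 <= i < n) (z i - 1))) <= n%:R * (11 * h ^+ 2).
Proof.
move=> c0 h0 h2 z1; have [_ _ law _] := hN.
pose t i := c + i%:R * h.
have nt : nondecreasing_seq t.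
  by move=> i j ij; rewrite lerD2l ler_pM2r// ler_nat.
rewrite (@Cmean_prod_increments t)//; last by rewrite /t mul0r addr0.
rewrite mulr_sumr cexp_sum.
apply: (@le_trans _ _ (\sum_(0 <= i < n) (11 * h ^+ 2))); last first.
  by rewrite sumr_const_nat subn0 -[leLHS]mulr_natl.
have app i : normc (Cmean P (fun w => z i ^+ (N (t i.+1) w - N (t i) w)%N) -
    cexp ((h%:C)%C * (z i - 1))) <= 11 * h ^+ 2.
  apply: Cmean_poisson_approx => //; first exact: mincr.
  move=> k; have -> : h = t i.+1 - t i by rewrite /t -natr1; ring.
  apply: law; first by rewrite addr_ge0// mulr_ge0// ltW.
  by rewrite /t ltrD2l ltr_pM2r// ltr_nat.
apply: le_trans (normc_prodB _ _) _.
- move=> i _; apply: normc_Cmean_le1.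
    exact: (bcmf_comp (mincr t i) (bcmf_exprn (z1 i))).
  by move=> w; rewrite normcX exprn_ile1 ?normc_ge0.
(* Since Re z <= |z| <= 1, the exponent h (z - 1) has nonpositive real part. *)
- move=> i _; rewrite normc_cexp ReM /= mul0r subr0 ReD /= expR_le1.
  rewrite pmulr_rle0//= subr_le0 (le_trans _ (z1 i))// (le_trans _ (Re_le_normc _))//.
  exact: ler_norm.
- by apply: ler_sum => i _; exact: app.
Qed.

End poisson_increments.

(** * Location of a point in a subdivision *)

Section pieces.
Context {R : realType}.
Implicit Types (t : nat -> R) (x : R).

(* The least [l <= n] with [x <= t l], and [n.+1] if there is none. *)
Definition piece t n x : 'I_n.+2 :=
  inord (find (fun i => x <= t i) (iota 0 n.+1)).

Lemma piece_val t n x :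
  piece t n x = find (fun i => x <= t i) (iota 0 n.+1) :> nat.
Proof.
rewrite inordK// ltnS.
by have := find_size (fun i => x <= t i) (iota 0 n.+1); rewrite size_iota.
Qed.

Lemma pieceP t n x (l : nat) : (l <= n.+1)%N ->
  (forall k, (k < l)%N -> t k < x) -> ((l <= n)%N -> x <= t l) ->
  piece t n x = l :> nat.
Proof.
move=> ln lo hi; rewrite piece_val; apply/eqP; rewrite eqn_leq; apply/andP; split.
  move: ln; rewrite leq_eqVlt => /predU1P[->|ln].
    by have := find_size (fun i => x <= t i) (iota 0 n.+1); rewrite size_iota.
  rewrite leqNgt; apply/negP => /(before_find 0%N).
  by rewrite nth_iota// add0n hi.
rewrite leqNgt; apply/negP => fl.
have fn : (find (fun i => (x <= t i)%R) (iota 0 n.+1) < n.+1)%N by exact: leq_trans ln.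
have : has (fun i => x <= t i) (iota 0 n.+1) by rewrite has_find size_iota.
move=> /(nth_find 0%N); rewrite nth_iota// add0n leNgt.
by rewrite lo.
Qed.

Lemma piece_lt t n x k : (k < piece t n x)%N -> t k < x.
Proof.
rewrite piece_val => kf; have := before_find 0%N kf.
rewrite nth_iota ?add0n; first by move/negbT; rewrite -ltNge.
apply: leq_trans kf _.
by have := find_size (fun i => x <= t i) (iota 0 n.+1); rewrite size_iota.
Qed.

Lemma piece_ge t n x : (piece t n x <= n)%N -> x <= t (piece t n x).
Proof.
rewrite piece_val => fn.
have : has (fun i => x <= t i) (iota 0 n.+1) by rewrite has_find size_iota.
by move=> /(nth_find 0%N); rewrite nth_iota.
Qed.

Lemma measurable_piece t n l : measurable [set x | piece t n x = l].
Proof.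
have -> : [set x | piece t n x = l] =
   \bigcap_(k in [set k | (k < l)%N]) `]t k, +oo[%classic `&`
   (if (l <= n)%N then `]-oo, t l]%classic else setT).
  apply/seteqP; split => [x /= <-|x /= [lo hi]].
    split; first by move=> k /= /piece_lt; rewrite in_itv/= andbT.
    by case: ifP => // /piece_ge; rewrite /= in_itv.
  apply: val_inj; apply: pieceP; first by rewrite -ltnS ltn_ord.
    by move=> k /lo; rewrite /= in_itv/= andbT.
  by move=> ln; move: hi; rewrite ln /= in_itv.
apply: measurableI; first by apply: bigcap_measurableType => k _.
by case: ifP.
Qed.

End pieces.

Lemma prod_nat_blocks (R : realType) (K : nat -> nat) (F : nat -> R[i]) n :
  {homo K : i j / (i <= j)%N} ->
  \prod_(K 0%N <= j < K n) F j = \prod_(0 <= i < n) \prod_(K i <= j < K i.+1) F j.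
Proof.
move=> hK; elim: n => [|n IH]; first by rewrite !big_geq.
by rewrite (@big_cat_nat _ _ _ (K n)) ?hK//= IH big_nat_recr.
Qed.

(** By the equivalence between [gam j <= t i] and [j < K i], the points of piece i + 1 are those
    with index from [K i] to [K i.+1] excluded. Indices below [K 0] fall in piece 0, those from
    [K n] on in piece n + 1, and both have factor 1. *)
Lemma prod_pieces (R : realType) (t : nat -> R) n (gam : nat -> R) (K : nat -> nat)
    (psi : nat -> R[i]) M : nondecreasing_seq t ->
  {homo K : i j / (i <= j)%N} ->
  (forall i j, (gam j <= t i) = (j < K i)%N) ->
  psi 0%N = 1 -> psi n.+1 = 1 -> (K n <= M)%N ->
  \prod_(0 <= j < M) psi (piece t n (gam j)) =
  \prod_(0 <= i < n) psi i.+1 ^+ (K i.+1 - K i).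
Proof.
move=> nt hK gK p0 pn KM.
have K0n : (K 0%N <= K n)%N by exact: hK.
rewrite (@big_cat_nat _ _ _ (K 0%N))//=; last exact: leq_trans KM.
rewrite [X in _ * X](@big_cat_nat _ _ _ (K n))//=.
rewrite [X in X * _]big_nat_cond [X in X * _]big1 ?mul1r; last first.
  by move=> j; rewrite andbT => /andP[_ jK]; rewrite (@pieceP _ _ _ _ 0%N)// gK.
rewrite [X in _ * X]big_nat_cond [X in _ * X]big1 ?mulr1; last first.
  move=> j; rewrite andbT => /andP[jK _]; rewrite (@pieceP _ _ _ _ n.+1)// ?ltnn// => k kn.
  by rewrite ltNge gK -leqNgt (leq_trans _ jK)// hK// -ltnS.
rewrite prod_nat_blocks//; apply: eq_big_nat => i /andP[_ ilt].
rewrite -prodr_const_nat; apply: eq_big_nat => j /andP[ij ji].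
rewrite (@pieceP _ _ _ _ i.+1)//.
- by rewrite ltnS ltnW.
- by move=> k ki; rewrite ltNge gK -leqNgt (leq_trans _ ij)// hK// -ltnS.
- by rewrite gK.
Qed.

Lemma cvg_bigsum (R : realType) I (r : seq I) (F : I -> nat -> R) (l : I -> R) :
  (forall i, F i @ \oo --> l i) ->
  (fun n => \sum_(i <- r) F i n) @ \oo --> \sum_(i <- r) l i.
Proof.
move=> Fl; elim: r => [|i r IH].
  by rewrite big_nil; under eq_fun do rewrite big_nil; exact: cvg_cst.
by rewrite big_cons; under eq_fun do rewrite big_cons; exact: cvgD.
Qed.

Section compound_poisson.
Context d (T : measurableType d) (R : realType) (P : probability T R).
Variables (N : R -> {RV P >-> nat}) (Gamma W : nat -> {RV P >-> R}).
Hypothesis hN : unit_poisson_process N.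
Hypothesis hGamma :
  {ae P, forall w, forall t j, 0 <= t -> (Gamma j w <= t) = (j < N t w)%N}.
Hypothesis indW : mutually_independent P (fun j => W j : T -> R).
Hypothesis eqW :
  forall j B, measurable B -> P (W j @^-1` B) = P (W 0%N @^-1` B).
Hypothesis indGW : independent_families P (fun j => Gamma j : T -> R)
  (fun j => W j : T -> R).
Variables (g : R -> R) (c D u : R).
Hypothesis mg : measurable_fun [set: R] g.
Hypothesis c0 : 0 <= c.
Hypothesis cD : c < D.
Hypothesis gc : forall x, c < x < D -> {for x, continuous g}.

Let chi (v : R) : R[i] := Cmean P (fun w => cis (v * W 0%N w)).
Let I (x : R) : R := \1_(`]c, D[%classic) x.
(** Independence needs a deterministic number of terms; almost surely nothing is lost when N_D <=
    M. *)
Let S M w := \sum_(0 <= j < M) I (Gamma j w) * (W j w * g (Gamma j w)).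
(** There are n + 1 pieces, of which only the first n will carry weight. *)
Let h n : R := (D - c) / n.+1%:R.
Let t n i : R := c + i%:R * h n.
(* The last piece ]t n n, D] has weight 0, so that an arrival at time [D] does
   not have to be excluded. *)
Let theta n (l : nat) : R := if (0 < l <= n)%N then g (t n l) else 0.
(** The probability that truncation at M may miss an arrival; every truncation error is a multiple
    of it. *)
Let p M : R := mean P (\1_[set w | (M < N D w)%N]).

Let h0 n : 0 < h n.
Proof. by rewrite divr_gt0// subr_gt0. Qed.

Let h_cvg : h @ \oo --> (0 : R).
Proof.
rewrite -(mulr0 (D - c)); apply: cvgM; first exact: cvg_cst.
exact: cvg_harmonic.
Qed.

Let tn_lt n i : (i <= n)%N -> t n i < D.
Proof.
move=> ni; have -> : D = c + n.+1%:R * h n.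
  by rewrite /h mulrCA mulfV// mulr1 addrC subrK.
by rewrite ltrD2l ltr_pM2r// ltr_nat.
Qed.

Let nd_t n : nondecreasing_seq (t n).
Proof. by move=> i j ij; rewrite lerD2l ler_pM2r// ler_nat. Qed.

Let t_ge0 n i : 0 <= t n i.
Proof. by rewrite addr_ge0// mulr_ge0// ltW. Qed.

(** Outside (c, D) the index is 0 or n + 1, of weight 0 for every n. Inside, x is eventually below
    the last piece and the right end of its piece is within [h n] of x, so continuity of [g]
    applies. *)
Let theta_cvg x : (fun n => theta n (piece (t n) n x)) @ \oo --> I x * g x.
Proof.
rewrite /I indicE; have [xc|cx] := leP x c.
  rewrite memNset ?mul0r/=; last by rewrite in_itv/= ltNge xc.
  apply: cvg_near_cst; apply: nearW => n.
  by rewrite (@pieceP _ _ _ _ 0%N)// /t mul0r addr0.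
have [Dx|xD] := leP D x.
  rewrite memNset ?mul0r/=; last by rewrite in_itv/= [x < D]ltNge Dx andbF.
  apply: cvg_near_cst; apply: nearW => n.
  rewrite (@pieceP _ _ _ _ n.+1)// ?ltnn//; first by rewrite /theta ltnn andbF.
  by move=> k kn; apply: lt_le_trans Dx; apply: tn_lt.
rewrite mem_set/=; last by rewrite in_itv/= cx.
rewrite mul1r; have gx : {for x, continuous g} by apply: gc; rewrite cx.
pose y n := t n (piece (t n) n x).
have y_near : \forall n \near \oo, theta n (piece (t n) n x) = g (y n) /\ `|y n - x| <= h n.
  have : \forall n \near \oo, h n <= D - x.
    move/cvgrPdist_le: h_cvg => /(_ (D - x)); rewrite subr_gt0 => /(_ xD).
    by apply: filterS => n; rewrite sub0r normrN gtr0_norm.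
  apply: filterS => n hn.
  have xt : x <= t n n.
    have -> : t n n = D - h n.
      by rewrite /t /h -[in RHS](@mulfK _ n.+1%:R _ D)// -natr1; field; rewrite natr1.
    lra.
  have pn : (piece (t n) n x <= n)%N.
    rewrite leqNgt; apply/negP => /piece_lt; rewrite ltNge xt.
    by [].
  have p0 : (0 < piece (t n) n x)%N.
    rewrite lt0n; apply/eqP => p0; have := piece_ge pn.
    by rewrite p0 /t mul0r addr0 leNgt cx.
  split; first by rewrite /theta p0 pn.
  have lo := piece_ge pn.
  have hi : t n (piece (t n) n x).-1 < x by apply: piece_lt; rewrite prednK.
  rewrite ger0_norm ?subr_ge0// /y.
  have -> : t n (piece (t n) n x) = t n (piece (t n) n x).-1 + h n.
    by rewrite /t -{1}(prednK p0) -natr1; ring.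
  lra.
have y_cvg : y @ \oo --> x.
  apply/cvgrPdist_le => e e0.
  move/cvgrPdist_le: h_cvg => /(_ e e0).
  apply: filterS2 y_near => n [_ yh]; rewrite sub0r normrN gtr0_norm// => he.
  by rewrite distrC (le_trans yh).
apply: cvg_trans (_ : g (y n) @[n --> \oo] --> g x).
  by apply: near_eq_cvg; apply: filterS y_near => n [].
exact: (continuous_cvg _ gx y_cvg).
Qed.

Let f n (l : nat) (y : R) : R[i] := cis (u * theta n l * y).

Let bf n l : bounded_cmfun (f n l).
Proof. by apply: bcmf_cis; exact: measurable_funM. Qed.

Let mGamma j : measurable_fun [set: T] (Gamma j).
Proof. exact: measurable_funPT. Qed.

Let mW j : measurable_fun [set: T] (W j).
Proof. exact: measurable_funPT. Qed.

Let mS M : measurable_fun [set: T] (S M).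
Proof.
apply: measurable_sum => j; apply: measurable_funM.
  by apply: measurableT_comp; [exact: measurable_indic|exact: mGamma].
by apply: measurable_funM => //; exact: measurableT_comp.
Qed.

Let V n M w := \prod_(0 <= j < M) f n (piece (t n) n (Gamma j w)) (W j w).

Let bV n M : bounded_cmfun (V n M).
Proof.
apply: bcmf_prod => j; rewrite /f; apply: bcmf_cis.
apply: measurable_funM => //; apply: measurable_funM => //.
apply: (@measurableT_comp _ _ _ _ _ _ (fun x => theta n (piece (t n) n x))) => //.
move=> _ B mB; rewrite setTI.
have -> : (fun x => theta n (piece (t n) n x)) @^-1` B =
    \bigcup_(l in [set l : 'I_n.+2 | B (theta n l)]) [set x | piece (t n) n x = l].
  apply/seteqP; split => [x /= Bx|x /= [l /= Bl ->//]].
  by exists (piece (t n) n x).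
apply: fin_bigcup_measurable => // l _; exact: measurable_piece.
Qed.

Let V_cvg M : ccvg (fun n => Cmean P (V n M)) (Cmean P (fun w => cis (u * S M w))).
Proof.
apply: (@Cmean_bounded_cvg _ _ _ _ _ _ 1) => //.
- by apply: bcmf_cis; exact: measurable_funM.
- apply: aeW => w; rewrite /V /f.
  under eq_fun do rewrite -cis_sum.
  apply: ccvg_cis; rewrite /S mulr_sumr; apply: cvg_bigsum => j.
  under eq_fun do rewrite mulrAC -mulrA.
  rewrite (_ : u * (I (Gamma j w) * (W j w * g (Gamma j w))) =
     u * W j w * (I (Gamma j w) * g (Gamma j w))); last by ring.
  by under eq_fun do rewrite mulrA; apply: cvgM; [exact: cvg_cst|exact: theta_cvg].
- by move=> n w; rewrite normc_prod big1// => j _; exact: normc_cis.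
Qed.

Let psi n l := chi (u * theta n l).

Let psi_le1 n l : normc (psi n l) <= 1.
Proof.
apply: normc_Cmean_le1; last by move=> w; rewrite normc_cis.
by apply: bcmf_cis; exact: measurable_funM.
Qed.

Let psi_theta0 n l : theta n l = 0 -> psi n l = 1.
Proof.
move=> t0; rewrite /psi /chi t0 mulr0.
by under eq_fun do rewrite mul0r cis0; rewrite Cmean_cst.
Qed.

Let mND M : measurable [set w | (M < N D w)%N].
Proof.
have := @measurable_funPT _ _ _ _ (N D) measurableT [set k | (M < k)%N].
by rewrite setTI; apply.
Qed.

Let bp M : bounded_mfun (\1_[set w | (M < N D w)%N] : T -> R).
Proof. exact: bmf_indic. Qed.

(** Integrating out the marks is exact ([E1]). Regrouping the arrivals by increments is exact when
    N_D <= M, and otherwise compares two numbers of norm at most 1 ([E2]). The Poisson approximation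
    on n pieces gives the last term ([E3]). *)
Let V_approx n M : h n <= 2^-1 ->
  normc (Cmean P (V n M) - cexp (((h n)%:C)%C * \sum_(0 <= i < n) (psi n i.+1 - 1)))
  <= 2 * p M + n%:R * (11 * h n ^+ 2).
Proof.
move=> hn2.
pose A w := \prod_(0 <= j < M) psi n (piece (t n) n (Gamma j w)).
pose B w := \prod_(0 <= i < n) psi n i.+1 ^+ (N (t n i.+1) w - N (t n i) w)%N.
have bA : bounded_cmfun A.
  apply: bcmf_prod => j.
  apply: (@bcmf_comp _ _ _ _ _ (fun x => psi n (piece (t n) n x)) (Gamma j)) => //.
  have mpsi (pr : R[i] -> R) : measurable_fun [set: R] (fun x => pr (psi n (piece (t n) n x))).
    move=> _ C mC; rewrite setTI.
    have -> : (fun x => pr (psi n (piece (t n) n x))) @^-1` C =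
        \bigcup_(l in [set l : 'I_n.+2 | C (pr (psi n l))]) [set x | piece (t n) n x = l].
      apply/seteqP; split => [x /= Bx|x /= [l /= Bl ->//]].
      by exists (piece (t n) n x).
    apply: fin_bigcup_measurable => // l _; exact: measurable_piece.
  split; split; try exact: mpsi; exists 1 => x; apply: le_trans (psi_le1 _ _);
    [exact: Re_le_normc|exact: Im_le_normc].
have bB : bounded_cmfun B.
  apply: bcmf_prod => i; apply: (@bcmf_comp _ _ _ _ _ (fun k : nat => psi n i.+1 ^+ k)).
    by apply: measurable_subn; exact: measurable_funPT.
  exact: bcmf_exprn.
have A1 w : normc (A w) <= 1 by apply: normc_prod_le1.
have B1 w : normc (B w) <= 1.
  by apply: normc_prod_le1 => i _; rewrite normcX exprn_ile1 ?normc_ge0.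
have E1 : Cmean P (V n M) = Cmean P A.
  have := @Cmean_marks _ _ _ P _ _ _ _ (fun j => Gamma j : T -> R)
    (fun j => W j : T -> R) mGamma mW indW eqW indGW 'I_n.+2 (piece (t n) n)
    (@measurable_piece _ (t n) n) (fun l => f n l) M (fun l => bf n l).
  exact.
have E2 : normc (Cmean P A - Cmean P B) <= 2 * p M.
  have bB' : bounded_cmfun (fun w => -1 * B w) by apply: bcmfM => //; exact: bcmf_cst.
  have -> : Cmean P A - Cmean P B = Cmean P (fun w => A w + -1 * B w).
    by rewrite CmeanD// CmeanZl// mulN1r.
  rewrite /p -meanZl; last exact: bmf_integrable.
  apply: normc_Cmean; [exact: bcmfD|by apply: bmfM => //; exact: bmf_cst|].
  have [_ mono _ _] := hN.
  apply: filterS2 hGamma mono => w hG mono; rewrite indicE.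
  have [NM|MN] := leqP (N D w) M; last first.
    rewrite mem_set// mulr1 mulN1r; apply: le_trans (le_normcD _ _) _.
    by rewrite normcN (_ : 2 = 1 + 1 :> R) ?lerD.
  rewrite memNset ?mulr0/=; last by rewrite ltnNge NM.
  suff -> : A w = B w by rewrite mulN1r subrr normc0.
  apply: (@prod_pieces _ (t n) n (fun j => Gamma j w) (fun i => N (t n i) w) (psi n)) => //.
  - by move=> i j ij; apply: mono => //; exact: nd_t.
  - by move=> i j; exact: hG.
  - exact: psi_theta0.
  - by apply: psi_theta0; rewrite /theta ltnn andbF.
  - by apply: leq_trans NM; apply: mono => //; exact/ltW/tn_lt.
have E3 := @increments_approx _ _ _ P N hN c (h n) (fun i => psi n i.+1) n c0 (h0 n)
  hn2 (fun i => psi_le1 n i.+1).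
rewrite E1 -[Cmean P A](subrK (Cmean P B)) -addrA.
by apply: le_trans (le_normcD _ _) _; exact: lerD.
Qed.

Let p_cvg : p @ \oo --> (0 : R).
Proof.
rewrite -(mean_cst P 0); apply: (@mean_bounded_cvg _ _ _ _ _ _ 1) => //.
- apply: aeW => w; apply: cvg_near_cst; near=> M.
  rewrite indicE memNset//= => /ltn_geF/negP; apply.
  by near: M; exact: nbhs_infty_ge.
- by move=> M w; rewrite indicE; case: (_ \in _); rewrite ?normr1 ?normr0.
Unshelve. all: by end_near. Qed.

(** For fixed M, letting n grow leaves a distance of at most 2 p_M between the characteristic
    function of the truncated sum and e^E; passing from that sum to [Z] costs another 2 p_M. Then M
    tends to infinity. *)
Lemma compound_poisson_charfun (Z : T -> R) (E : R[i]) :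
  measurable_fun [set: T] Z ->
  {ae P, forall w, forall M, (N D w <= M)%N ->
    Z w = \sum_(0 <= j < M) \1_(`]c, D[%classic) (Gamma j w) *
            (W j w * g (Gamma j w))} ->
  ccvg (fun n => (((D - c) / n.+1%:R)%:C)%C * \sum_(0 <= i < n)
    (Cmean P (fun w => cis (u * g (c + i.+1%:R * ((D - c) / n.+1%:R)) * W 0%N w)) - 1)) E ->
  Cmean P (fun w => cis (u * Z w)) = cexp E.
Proof.
move=> mZ ZS hE.
have hE' : ccvg (fun n => ((h n)%:C)%C * \sum_(0 <= i < n) (psi n i.+1 - 1)) E.
  move: hE; congr ccvg; apply/funext => n; congr (_ * _).
  symmetry; apply: eq_big_nat => i /andP[_ ilt]; congr (_ - _).
  by rewrite /psi /chi /theta ltnS leq0n /= ilt.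
have S_E M : normc (Cmean P (fun w => cis (u * S M w)) - cexp E) <= 2 * p M.
  have l1 := ccvg_normc (ccvgD (V_cvg M) (ccvgN (ccvg_cexp hE'))).
  (* As (n + 1) h = D - c, the accumulated error is at most 11 (D - c) h. *)
  have l2 : 2 * p M + n%:R * (11 * h n ^+ 2) @[n --> \oo] --> 2 * p M + 0.
    apply: cvgD; first exact: cvg_cst.
    have : 11 * (D - c) * h n @[n --> \oo] --> 11 * (D - c) * 0.
      by apply: cvgM => //; exact: cvg_cst.
    rewrite mulr0; apply: squeeze_cvgr (cvg_cst 0).
    near=> n; have hh : 0 <= 11 * h n ^+ 2.
      by apply: mulr_ge0 => //; exact: sqr_ge0.
    apply/andP; split; first by apply: mulr_ge0.
    have -> : 11 * (D - c) * h n = n.+1%:R * (11 * h n ^+ 2).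
      by rewrite /h; field; rewrite ?natr1 ?nat1r ?pnatr_eq0.
    by apply: ler_wpM2r => //; rewrite ler_nat.
  rewrite -[leRHS]addr0; apply: (ler_cvg_to l1 l2).
  have : \forall n \near \oo, h n <= 2^-1.
    move/cvgrPdist_le: h_cvg => /(_ 2^-1); rewrite invr_gt0 ltr0n => /(_ isT).
    by apply: filterS => n; rewrite sub0r normrN gtr0_norm.
  by apply: filterS => n; exact: V_approx.
have Z_S M : normc (Cmean P (fun w => cis (u * Z w)) - Cmean P (fun w => cis (u * S M w)))
    <= 2 * p M.
  have b1 : bounded_cmfun (fun w => cis (u * Z w)) by apply: bcmf_cis; exact: measurable_funM.
  have b2 : bounded_cmfun (fun w => cis (u * S M w)) by apply: bcmf_cis; exact: measurable_funM.
  have b3 : bounded_cmfun (fun w => -1 * cis (u * S M w)).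
    by apply: bcmfM => //; exact: bcmf_cst.
  rewrite -mulN1r -CmeanZl// -CmeanD// /p -meanZl; last exact: bmf_integrable.
  apply: normc_Cmean; [exact: bcmfD|by apply: bmfM => //; exact: bmf_cst|].
  apply: filterS ZS => w ZS; rewrite indicE.
  have [NM|MN] := leqP (N D w) M.
    rewrite memNset; last by rewrite /= ltnNge NM.
    by rewrite [2 * _]mulr0 (ZS M)// mulN1r subrr normc0.
  rewrite mem_set// mulr1 mulN1r; apply: le_trans (le_normcD _ _) _.
  by rewrite normcN !normc_cis (_ : 2 = 1 + 1 :> R).
apply/eqP; rewrite -subr_eq0; apply/eqP/eq0_normc/eqP.
rewrite eq_le normc_ge0 andbT.
have l4 : 4 * p M @[M --> \oo] --> (4 * 0 : R) by apply: cvgM => //; exact: cvg_cst.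
rewrite mulr0 in l4; apply: (ler_cvg_to (cvg_cst _) l4); apply: nearW => M.
rewrite -[Cmean P _](subrK (Cmean P (fun w => cis (u * S M w)))) -addrA.
apply: le_trans (le_normcD _ _) _; apply: le_trans (lerD (Z_S M) (S_E M)) _.
lra.
Unshelve. all: by end_near. Qed.

End compound_poisson.

(** * Exponential moments *)

Import HBNNSimple.

(** An inequality is enough for finiteness. The left side is a supremum over simple functions g <=
    f, and the integral of each is computed fibre by fibre as that of g p. *)
Lemma ge0_integral_density_le d (T : measurableType d) (R : realType)
    (mu nu : {measure set T -> \bar R}) (p f : T -> R) :
  measurable_fun [set: T] p -> (forall x, 0 <= p x) ->
  measurable_fun [set: T] f -> (forall x, 0 <= f x) ->
  (forall A, measurable A -> nu A = \int[mu]_(x in A) (p x)%:E)%E ->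
  (\int[nu]_x (f x)%:E <= \int[mu]_x (f x * p x)%:E)%E.
Proof.
move=> mp p0 mf f0 nuE.
rewrite ge0_integralTE; last by move=> x; rewrite lee_fin.
apply: ub_ereal_sup => _ [g gf <-].
have mg y : measurable (g @^-1` [set y]) by exact: measurable_sfunP.
have t0 y x : 0 <= y * \1_(g @^-1` [set y]) x * p x.
  rewrite mulr_ge0// indicE; have [/set_mem/= <-|_] := boolP (x \in _).
    by rewrite mulr1.
  by rewrite mulr0.
have mt y : measurable_fun [set: T] (fun x => y * \1_(g @^-1` [set y]) x * p x).
  by apply: measurable_funM => //; apply: measurable_funM => //; exact: measurable_indic.
rewrite sintegralE fsbig_finite//=.
have E y : y \in finmap.enum_fset (fset_set (range g)) ->
    (y%:E * nu (g @^-1` [set y]) =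
     \int[mu]_x (y * \1_(g @^-1` [set y]) x * p x)%:E)%E.
  move=> yg; have y0 : 0 <= y.
    by move: yg; rewrite in_fset_set// => /set_mem[x _ <-].
  rewrite nuE// integral_mkcond/= -ge0_integralZl//=; last 2 first.
  - by apply/(measurable_restrictT _ (mg y)); apply: measurable_funTS; exact/measurable_EFinP.
  - by move=> x _; rewrite patchE; case: ifP => // _; rewrite lee_fin.
  apply: eq_integral => x _; rewrite patchE indicE; case: ifP => _.
    by rewrite mulr1 EFinM.
  by rewrite mulr0 mul0r mule0.
rewrite big_seq (eq_bigr _ E) -big_seq -ge0_integral_sum//=; last 2 first.
- by move=> y; exact/measurable_EFinP.
- by move=> y x _; rewrite lee_fin.
apply: ge0_le_integral => //.
- by move=> x _; apply: sume_ge0 => y _; rewrite lee_fin.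
- by apply: emeasurable_sum => y; exact/measurable_EFinP.
- by apply/measurable_EFinP; exact: measurable_funM.
move=> x _; rewrite sumEFin lee_fin -mulr_suml ler_wpM2r//.
have := gf x; rewrite lee_fin {1}(fimfunE g) fsbig_finite//=; exact.
Qed.

(** Completing the square: exponential tilting shifts the mean of a normal density. *)
Lemma normal_exp_shift (R : realType) (m s r x : R) : s != 0 ->
  expR (r * x) * normal_pdf m s x =
  expR (r * m + r ^+ 2 * s ^+ 2 / 2) * normal_pdf (m + r * s ^+ 2) s x.
Proof.
move=> s0; rewrite !normal_pdfE// /normal_fun mulrCA [in RHS]mulrCA; congr (_ * _).
by rewrite -!expRD; congr expR; rewrite -(mulr_natr (s ^+ 2)); field.
Qed.

(** e^(r |x|) <= e^(r x) + e^(-r x), and against the normal density each summand is a constant times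
    a shifted normal density. The degenerate law is a Dirac mass. *)
Lemma gaussian_exp_integral_lty d (T : measurableType d) (R : realType)
    (P : probability T R) (X : {RV P >-> R}) (m s r : R) :
  (forall A : set R, measurable A -> distribution P X A = gaussian_law m s A) ->
  (\int[P]_w (expR (r * `|X w|))%:E < +oo)%E.
Proof.
move=> law.
have mexp : measurable_fun [set: R] (fun x : R => expR (r * `|x|)).
  by apply: measurableT_comp => //; exact: measurable_funM.
have mE : measurable_fun [set: R] (fun x : R => (expR (r * `|x|))%:E).
  exact/measurable_EFinP.
have [s0|s0] := eqVneq s 0.
  rewrite -(@ge0_integral_distribution _ _ _ _ _ P X (fun x => (expR (r * `|x|))%:E))//.
  rewrite (@eq_measure_integral _ _ _ _ (\d_m)); last first.
    by move=> A mA _; apply: (etrans (law A mA)); rewrite /gaussian_law s0 eqxx.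
  by rewrite integral_dirac// diracT mul1e ltry.
(* The Lebesgue measure lives on [measurableTypeR R], which is not the canonical
   measurable structure of [R]. *)
have mX : @measurable_fun _ _ T (measurableTypeR R) setT X.
  exact: (@measurable_funPT _ _ _ _ X).
pose X' : {mfun T >-> measurableTypeR R} := HB.pack (X : T -> measurableTypeR R)
  (@isMeasurableFun.Build _ _ T (measurableTypeR R) X mX).
rewrite -(@ge0_integral_distribution _ _ _ _ _ P X' (fun x => (expR (r * `|x|))%:E))//.
have law' (A : set (measurableTypeR R)) : measurable A ->
    distribution P X' A = (\int[lebesgue_measure]_(x in A) (normal_pdf m s x)%:E)%E.
  move=> mA; transitivity (distribution P X A) => //.
  by rewrite law// /gaussian_law (negbTE s0).
have le := @ge0_integral_density_le _ (measurableTypeR R) R lebesgue_measure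
  (distribution P X')
  (normal_pdf m s) (fun x => expR (r * `|x|)) (measurable_normal_pdf m s)
  (normal_pdf_ge0 m s) mexp (fun x => expR_ge0 _) law'.
apply: le_lt_trans le _.
pose F (r' : R) (x : R) := expR (r' * m + r' ^+ 2 * s ^+ 2 / 2) * normal_pdf (m + r' * s ^+ 2) s x.
have FE r' x : F r' x = expR (r' * x) * normal_pdf m s x by rewrite normal_exp_shift.
have mF r' : measurable_fun [set: R] (F r').
  by apply: measurable_funM => //; exact: measurable_normal_pdf.
have mFE r' : measurable_fun [set: measurableTypeR R]
    (fun x : measurableTypeR R => (F r' x)%:E).
  by apply/measurable_EFinP; exact: mF.
have F0 r' x : 0 <= F r' x by rewrite mulr_ge0 ?expR_ge0 ?normal_pdf_ge0.
have IF r' : (\int[lebesgue_measure]_x (F r' x)%:E =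
    (expR (r' * m + r' ^+ 2 * s ^+ 2 / 2))%:E)%E.
  under eq_integral do rewrite EFinM.
  rewrite ge0_integralZl//=.
  - by rewrite integral_normal_pdf mule1.
  - by apply/measurable_EFinP; exact: measurable_normal_pdf.
  - by move=> x _; rewrite lee_fin normal_pdf_ge0.
apply: (@le_lt_trans _ _ (\int[lebesgue_measure]_x ((F r x)%:E + (F (- r) x)%:E))%E).
  apply: ge0_le_integral => //.
  - by move=> x _; rewrite lee_fin mulr_ge0 ?expR_ge0 ?normal_pdf_ge0.
  - by apply/measurable_EFinP/measurable_funM => //; exact: measurable_normal_pdf.

  - by apply: emeasurable_funD; exact: mFE.
  move=> x _; rewrite -EFinD lee_fin !FE -mulrDl.
  rewrite ler_wpM2r ?normal_pdf_ge0//.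
  have [x0|x0] := leP 0 x; first by rewrite ger0_norm// lerDl expR_ge0.
  by rewrite ltr0_norm// mulrN mulNr lerDr expR_ge0.
rewrite ge0_integralD//=.
- by rewrite !IF -EFinD ltry.
- by move=> x _; rewrite lee_fin.
- by move=> x _; rewrite lee_fin.
Qed.

Section exponential_moments.
Context d (T : measurableType d) (R : realType) (P : probability T R).
Variable X : T -> R.
Hypothesis mX : measurable_fun [set: T] X.
Hypothesis hX : forall r, (\int[P]_w (expR (r * `|X w|))%:E < +oo)%E.

Let mXk k : measurable_fun [set: T] (fun w => X w ^+ k).
Proof. exact: measurable_funX. Qed.

Let int_exp r : P.-integrable [set: T] (EFin \o (fun w => expR (r * `|X w|))).
Proof.
apply/integrableP; split.
  apply/measurable_EFinP/measurableT_comp => //; apply: measurable_funM => //.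
  exact: measurableT_comp.
by under eq_integral do rewrite /= ger0_norm ?expR_ge0//; exact: hX.
Qed.

Lemma exp_partial_sum_le (x : R) n : 0 <= x ->
  \sum_(0 <= k < n) x ^+ k / k`!%:R <= expR x.
Proof.
move=> x0; apply: (@nondecreasing_cvgn_le _ (series (exp_coeff x))).
  apply/nondecreasing_seqP => m; rewrite /series/= big_nat_recr//= lerDl.
  exact: exp_coeff_ge0.
exact: is_cvg_series_exp_coeff.
Qed.

(** |X|^k / k! is one term of the series of e^|X|. *)
Let int_pow k : P.-integrable [set: T] (EFin \o (fun w => X w ^+ k)).
Proof.
have h := integrableZl measurableT k`!%:R (int_exp 1).
apply: (le_integrable measurableT _ _ h); first exact/measurable_EFinP.
move=> w _; rewrite /= lee_fin normrX mul1r normrM normr_nat.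
rewrite (ger0_norm (expR_ge0 _)).
have := @exp_partial_sum_le `|X w| k.+1 (normr_ge0 _); rewrite big_nat_recr//=.
rewrite -ler_pdivrMl ?ltr0n ?fact_gt0// mulrC; apply: le_trans.
by rewrite lerDr sumr_ge0// => i _; rewrite divr_ge0 ?exprn_ge0.
Qed.

Let int_abs k : P.-integrable [set: T] (EFin \o (fun w => `|X w| ^+ k)).
Proof.
apply: (le_integrable measurableT _ _ (int_pow k)).
  by apply/measurable_EFinP/measurable_funX/measurableT_comp.
by move=> w _; rewrite /= lee_fin -normrX normr_id.
Qed.

Let mean_sum (a : nat -> R) (Y : nat -> T -> R) n :
  (forall k, P.-integrable [set: T] (EFin \o Y k)) ->
  P.-integrable [set: T] (EFin \o (fun w => \sum_(0 <= k < n) a k * Y k w)) /\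
  mean P (fun w => \sum_(0 <= k < n) a k * Y k w) =
  \sum_(0 <= k < n) a k * mean P (Y k).
Proof.
move=> iY; elim: n => [|n [IH1 IH2]].
  split; last by under eq_fun do rewrite big_nil; rewrite mean_cst big_nil.
  rewrite (_ : _ \o _ = cst 0%E); first exact: integrable0.
  by apply/funext => w /=; rewrite big_nil.
have iZ := integrableZl measurableT (a n) (iY n).
split.
  rewrite (_ : _ \o _ = (fun w => (\sum_(0 <= k < n) a k * Y k w)%:E + (a n)%:E * (Y n w)%:E)%E).
    exact: integrableD.
  by apply/funext => w /=; rewrite big_nat_recr//=.
under eq_fun do rewrite big_nat_recr//=.
by rewrite meanD// IH2 meanZl// [in RHS]big_nat_recr.
Qed.

(** The partial sums increase and are bounded by the mean of e^(r |X|). *)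
Lemma moments_series_cvg (r : R) : 0 <= r ->
  cvgn (series (fun k => `|mean P (fun w => X w ^+ k)| * r ^+ k / k`!%:R)).
Proof.
move=> r0; apply: nondecreasing_is_cvgn.
  apply/nondecreasing_seqP => m; rewrite /series/= big_nat_recr//= lerDl.
  by rewrite divr_ge0 ?mulr_ge0 ?exprn_ge0.
exists (mean P (fun w => expR (r * `|X w|))) => _ [n _ <-].
have [i1 e1] := mean_sum (fun k => r ^+ k / k`!%:R) n int_abs.
apply: (@le_trans _ _ (mean P (fun w =>
    \sum_(0 <= k < n) r ^+ k / k`!%:R * `|X w| ^+ k))).
  rewrite e1 /series/=; apply: ler_sum => k _.
  rewrite -mulrA mulrC ler_wpM2l ?divr_ge0 ?exprn_ge0//.
  rewrite !meanE; apply: le_trans (le_normr_Rintegral _ _) _ => //.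
  by under eq_Rintegral do rewrite normrX.
apply: le_mean => //.
move=> w; apply: le_trans (exp_partial_sum_le n _); last by rewrite mulr_ge0.
by apply: ler_sum => k _; rewrite exprMn mulrAC.
Qed.

Lemma Cmean_cis_csum v :
  has_csum (fun k => icoef k * ((mean P (fun w => X w ^+ k) * v ^+ k)%:C)%C)
    (Cmean P (fun w => cis (v * X w))).
Proof.
(* Real and imaginary parts are handled at once by an abstract [pr]. Mean and series are exchanged
   by dominated convergence, e^(|v| |X|) bounding all partial sums. *)
have part (pr : R[i] -> R) (prD : {morph pr : x y / x + y}) (pr0 : pr 0 = 0)
    (prZ : forall z t, pr (z * (t%:C)%C) = pr z * t)
    (prN : forall z, `|pr z| <= normc z)
    (mpr : measurable_fun [set: T] (fun w => pr (cis (v * X w))))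
    (cpr : forall t, pr (\sum_(0 <= k < n) icoef k * ((t ^+ k)%:C)%C) @[n --> \oo] --> pr (cis t)) :
    pr (\sum_(0 <= k < n) icoef k * ((mean P (fun w => X w ^+ k) * v ^+ k)%:C)%C)
    @[n --> \oo] --> mean P (fun w => pr (cis (v * X w))).
  have prS I (s : seq I) F : pr (\sum_(i <- s) F i) = \sum_(i <- s) pr (F i).
    exact: (big_morph pr prD pr0).
  pose F n w := \sum_(0 <= k < n) (pr (icoef k) * v ^+ k) * X w ^+ k.
  have EF n w : F n w = pr (\sum_(0 <= k < n) icoef k * (((v * X w) ^+ k)%:C)%C).
    by rewrite prS; apply: eq_bigr => k _; rewrite prZ exprMn mulrA.
  have EM n : mean P (F n) =
      pr (\sum_(0 <= k < n) icoef k * ((mean P (fun w => X w ^+ k) * v ^+ k)%:C)%C).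
    have [_ ->] := mean_sum (fun k => pr (icoef k) * v ^+ k) n int_pow.
    by rewrite prS; apply: eq_bigr => k _; rewrite prZ mulrAC mulrA.
  under eq_fun do rewrite -EM.
  apply: (@mean_dominated_cvg _ _ _ _ _ _ (fun w => expR (`|v| * `|X w|))) => //.
  - move=> n; apply: measurable_sum => k; exact: measurable_funM.
  - by apply: aeW => w; under eq_fun do rewrite EF; exact: cpr.
  - move=> n w; rewrite EF; apply: le_trans (prN _) _.
    apply: le_trans (ler_normc_sum _ _ _) _; rewrite -normrM.
    apply: le_trans (exp_partial_sum_le n (normr_ge0 _)).
    apply: ler_sum => k _.
    by rewrite normcM normc_icoef normc_real normrX mulrC.
have mvX : measurable_fun [set: T] (fun w => v * X w) by exact: measurable_funM.
have [[m1 _] [m2 _]] := bcmf_cis mvX.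
split.
- apply: (part (@complex.Re R)) => //; [exact: ReD| |exact: Re_le_normc|].
    by move=> z t; rewrite ReM /= mulr0 subr0.
  by move=> t; have [] := cis_csum t.
- apply: (part (@complex.Im R)) => //; [exact: ImD| |exact: Im_le_normc|].
    by move=> z t; rewrite ImM /= mulr0 add0r.
  by move=> t; have [] := cis_csum t.
Qed.

End exponential_moments.

(** * Limit of the exponent *)

Section power_functions.
Context {R : realType}.
Implicit Types (p q x y a b : R).

Lemma ler_powRN p x y : 0 <= p -> 0 < x -> x <= y -> y `^ (- p) <= x `^ (- p).
Proof.
move=> p0 x0 xy; have y0 := lt_le_trans x0 xy.
rewrite !powRN lef_pV2 ?posrE ?powR_gt0//.
by apply: ge0_ler_powR => //; rewrite nnegrE ltW.
Qed.

Lemma powRN_cvg0 q : 0 < q -> (fun n : nat => n%:R `^ (- q)) @ \oo --> (0 : R).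
Proof.
move=> q0; apply/cvgrPdist_lt => e e0; near=> n.
have n0 : 0 < n%:R :> R by near: n; exact: nbhs_infty_gtr.
rewrite sub0r normrN ger0_norm ?powR_ge0// powRN invf_plt ?posrE ?powR_gt0//.
have en : e^-1 `^ (q^-1) < n%:R by near: n; exact: nbhs_infty_gtr.
have := gt0_ltr_powR q0 _ _ en; rewrite !nnegrE => /(_ (powR_ge0 _ _) (ltW n0)).
by rewrite -powRrM mulVf ?gt_eqF// powRr1// invr_ge0 ltW.
Unshelve. all: by end_near. Qed.

(** For p != 1, the primitive of x^(-p) on x > 0 without additive constant, so that it vanishes at
    infinity when p > 1. *)
Definition powR_primitive p x : R := x `^ (1 - p) / (1 - p).

Lemma powR_primitive_bounds p a b : 0 <= p -> p != 1 -> 0 < a -> a < b ->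
  b `^ (- p) * (b - a) <= powR_primitive p b - powR_primitive p a
    <= a `^ (- p) * (b - a).
Proof.
move=> p0 p1 a0 ab.
have dG x : 0 < x -> is_derive x (1 : R) (powR_primitive p) (x `^ (- p)).
  move=> x0; have h := @is_derive1_powR R (1 - p) x x0.
  have -> : powR_primitive p = (1 - p)^-1 \*: (@powR R ^~ (1 - p)).
    by apply/funext => z; rewrite /powR_primitive mulrC.
  apply: is_derive_eq; rewrite -[LHS]/(_ * _).
  rewrite mulrA mulVf ?mul1r; last by rewrite subr_eq0 eq_sym.
  by congr (_ `^ _); ring.
have [] := @MVT _ (powR_primitive p) (fun x => x `^ (- p)) a b ab.
- by move=> x; rewrite in_itv/= => /andP[ax _]; apply: dG; exact: lt_trans ax.
- apply: continuous_in_subspaceT => x; rewrite inE/= in_itv/= => /andP[ax _].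
  apply: differentiable_continuous; apply/derivable1_diffP.
  have dx : 0 < x by exact: lt_le_trans ax.
  by have [] := dG _ dx.
move=> x; rewrite in_itv/= => /andP[ax xb] ->.
have x0 : 0 < x by exact: lt_trans ax.
by rewrite !ler_wpM2r ?subr_ge0 ?(ltW ab)// ler_powRN// ltW.
Qed.

(** The integrand decreases, so right ends give a lower sum. The left ends of the n + 1 pieces are c
    and the first n right ends, so the upper sum exceeds the given one by exactly h c^(-p). *)
Lemma riemann_sum_powRN p c D n h : 0 <= p -> p != 1 -> 0 < c -> c < D ->
  h = (D - c) / n.+1%:R ->
  0 <= powR_primitive p D - powR_primitive p c -
       h * \sum_(0 <= i < n) (c + i.+1%:R * h) `^ (- p) <= h * c `^ (- p).
Proof.
move=> p0 p1 c0 cD hE; pose t i := c + i%:R * h.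
have h0 : 0 < h by rewrite hE divr_gt0// subr_gt0.
have tn : t n.+1 = D by rewrite /t hE mulrCA mulfV// mulr1 addrC subrK.
have t0 : t 0%N = c by rewrite /t mul0r addr0.
have tS i : t i.+1 = t i + h by rewrite /t -natr1; ring.
have tD i : t i.+1 - t i = h by rewrite tS addrAC subrr add0r.
have tp i : 0 < t i by rewrite ltr_wpDr// mulr_ge0// ltW.
have B i := @powR_primitive_bounds p (t i) (t i.+1) p0 p1 (tp i).
have tlt i : t i < t i.+1 by rewrite tS ltrDl.
have tel : powR_primitive p D - powR_primitive p c =
    \sum_(0 <= i < n.+1) (powR_primitive p (t i.+1) - powR_primitive p (t i)).
  by rewrite telescope_sumr// tn t0.
have lo : h * \sum_(0 <= i < n.+1) t i.+1 `^ (- p) <=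
    powR_primitive p D - powR_primitive p c.
  rewrite tel mulr_sumr; apply: ler_sum => i _.
  by have /andP[+ _] := B i (tlt i); rewrite tD mulrC.
have hi : powR_primitive p D - powR_primitive p c <=
    h * \sum_(0 <= i < n.+1) t i `^ (- p).
  rewrite tel mulr_sumr; apply: ler_sum => i _.
  by have /andP[_] := B i (tlt i); rewrite tD mulrC.
rewrite big_nat_recr//= mulrDr in lo; rewrite big_nat_recl//= t0 mulrDr in hi.
rewrite -/(t _); apply/andP; split.
  rewrite subr_ge0; apply: le_trans lo.
  by rewrite lerDl mulr_ge0 ?powR_ge0// ltW.
by rewrite lerBlDr.
Qed.

End power_functions.

(** * Exponents as moment series *)

Section exponents.
Context d (T : measurableType d) (R : realType) (P : probability T R).
Variable X : T -> R.
Hypothesis mX : measurable_fun [set: T] X.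
Hypothesis hX : forall r, (\int[P]_w (expR (r * `|X w|))%:E < +oo)%E.
Variables (alpha c u : R).
Hypothesis alpha0 : 0 < alpha.
Hypothesis c0 : 0 < c.

Let m k := mean P (fun w => X w ^+ k).
(** The bound on the jump sizes beyond c; all coefficients are measured against its powers. *)
Let rho := c `^ (- alpha^-1).

(* Terms of the expansion of [E[exp (i u X J) - 1]] when [x k] stands for the
   (integrated) [k]-th power of the jump size [J]. *)
Definition cumulant_term (x : nat -> R) k : R[i] :=
  if k == 0%N then 0 else icoef k * ((m k * u ^+ k * x k)%:C)%C.

Let rho0 : 0 < rho. Proof. exact: powR_gt0. Qed.

Lemma powR_invX x k : 0 < x -> (x `^ (- alpha^-1)) ^+ k = x `^ (- (k%:R / alpha)).
Proof.
move=> x0; rewrite -powR_mulrn ?powR_ge0// -powRrM; congr (_ `^ _).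
by rewrite mulNr mulrC.
Qed.

Let y k := `|m k| * (`|u| * rho) ^+ k / k`!%:R.

Let y_cvg : cvgn (series y).
Proof. by apply: moments_series_cvg => //; rewrite mulr_ge0// ltW. Qed.

Let y_ge0 k : 0 <= y k.
Proof.
apply: divr_ge0 => //; apply: mulr_ge0 => //; apply: exprn_ge0.
by apply: mulr_ge0 => //; exact: ltW.
Qed.

Let rhoX k : 0 <= rho ^+ k.
Proof. by apply: exprn_ge0; exact: ltW. Qed.

Let By_cvg B : series (fun k => B * y k) @ \oo --> B * limn (series y).
Proof.
rewrite (_ : series _ = fun n => B * series y n).
  by apply: cvgM; [exact: cvg_cst|exact: y_cvg].
by apply/funext => n; rewrite /series/= mulr_sumr.
Qed.

Let term_le (x : nat -> R) B : 0 <= B ->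
  (forall k, (0 < k)%N -> `|x k| <= B * rho ^+ k) ->
  forall k, normc (cumulant_term x k) <= B * y k.
Proof.
move=> B0 xB k; rewrite /cumulant_term; case: eqP => [_|/eqP k0].
  by rewrite normc0 mulr_ge0 ?y_ge0.
rewrite normcM normc_icoef normc_real !normrM normrX /y exprMn.
have := xB k; rewrite lt0n k0 => /(_ isT) h.
rewrite (_ : B * _ = k`!%:R^-1 * (`|m k| * `|u| ^+ k * (B * rho ^+ k))); last by ring.
by rewrite ler_wpM2l ?invr_ge0// ler_wpM2l// mulr_ge0 ?exprn_ge0.
Qed.

Lemma cumulant_exists (x : nat -> R) B : 0 <= B ->
  (forall k, (0 < k)%N -> `|x k| <= B * rho ^+ k) ->
  exists l, has_csum (cumulant_term x) l.
Proof.
move=> B0 xB; apply: (has_csum_exists (term_le B0 xB)).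
by apply/cvg_ex; exists (B * limn (series y)); exact: By_cvg.
Qed.

(** Turns a bound on coefficients, uniform relative to [rho ^+ k], into a bound on the sum;
    differences of exponents are estimated this way in both limits. *)
Lemma cumulant_le (x : nat -> R) B l : 0 <= B ->
  (forall k, (0 < k)%N -> `|x k| <= B * rho ^+ k) ->
  has_csum (cumulant_term x) l -> normc l <= B * limn (series y).
Proof. by move=> B0 xB hl; exact: (has_csum_normc hl (term_le B0 xB)). Qed.

Lemma cumulantB (x1 x2 : nat -> R) l1 l2 : has_csum (cumulant_term x1) l1 ->
  has_csum (cumulant_term x2) l2 ->
  has_csum (cumulant_term (fun k => x1 k - x2 k)) (l1 - l2).
Proof.
move=> h1 h2; have := has_csumB h1 h2; congr has_csum; apply/funext => k.
rewrite /cumulant_term; case: eqP => _; first by rewrite subrr.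
by rewrite -mulrBr -rmorphB -mulrBr.
Qed.

(** Compensation alters only the coefficient k = 1. *)
Lemma cumulant_single (b : R) :
  has_csum (cumulant_term (fun k => if k == 1%N then b else 0))
    ('i%C * ((m 1 * u * b)%:C)%C).
Proof.
have := has_csum_single 1%N ('i%C * ((m 1 * u * b)%:C)%C); congr has_csum.
apply/funext => k; rewrite /cumulant_term.
case: (eqVneq k 1%N) => [->|k1]; first by rewrite icoef1 expr1.
by case: eqP => // _; rewrite mulr0 rmorph0 mulr0.
Qed.

Let chi v := Cmean P (fun w => cis (v * X w)).

(** Subtracting 1 removes the zeroth moment. Riemann sums thereby become series of the same shape as
    the limiting exponent, with power sums as coefficients. *)
Let cumulant_points (s : seq R) (h : R) :
  has_csum (cumulant_term (fun k => h * \sum_(x <- s) x ^+ k))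
    ((h%:C)%C * \sum_(x <- s) (chi (u * x) - 1)).
Proof.
have h1 x : has_csum (cumulant_term (fun k => x ^+ k)) (chi (u * x) - 1).
  have := has_csumB (Cmean_cis_csum mX hX (u * x)) (has_csum_single 0%N 1).
  congr has_csum; apply/funext => k; rewrite /cumulant_term.
  case: eqP => [->|_].
    under eq_fun do rewrite expr0.
    by rewrite mean_cst expr0 mulr1 icoef0 mul1r subrr.
  by rewrite subr0 exprMn mulrA.
have := has_csumZ ((h%:C)%C) (has_csum_big s h1); congr has_csum.
apply/funext => k; rewrite /cumulant_term; case: eqP => _.
  by rewrite big1// mulr0.
rewrite -mulr_sumr mulrCA; congr (_ * _).
rewrite -rmorph_sum -rmorphM/=; congr (_%:C)%C.
by rewrite -mulr_sumr; ring.
Qed.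

Hypothesis alpha_nat : forall k, (0 < k)%N -> k%:R != alpha.

Let p k : R := k%:R / alpha.

Let p_ge0 k : 0 <= p k. Proof. by rewrite divr_ge0// ltW. Qed.

Let p_neq1 k : (0 < k)%N -> p k != 1.
Proof.
move=> k0; rewrite /p; apply/negP => /eqP/(congr1 ( *%R^~ alpha)).
by rewrite divfK ?gt_eqF// mul1r => /eqP; rewrite (negbTE (alpha_nat k0)).
Qed.

(** The k-th coefficients differ by at most [h n * rho ^+ k], by [riemann_sum_powRN], so the sums
    differ by a constant times [h n]. *)
Lemma riemann_cumulant D : c < D ->
  exists2 E, has_csum (cumulant_term
      (fun k => powR_primitive (p k) D - powR_primitive (p k) c)) E &
    ccvg (fun n => (((D - c) / n.+1%:R)%:C)%C * \sum_(0 <= i < n)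
      (Cmean P (fun w => cis (u *
        (c + i.+1%:R * ((D - c) / n.+1%:R)) `^ (- alpha^-1) * X w)) - 1)) E.
Proof.
move=> cD; pose h n : R := (D - c) / n.+1%:R.
have h0 n : 0 < h n by rewrite divr_gt0// subr_gt0.
have rhoE k : c `^ (- p k) = rho ^+ k by rewrite powR_invX.
have Kle k : (0 < k)%N -> `|powR_primitive (p k) D - powR_primitive (p k) c| <=
    (D - c) * rho ^+ k.
  move=> k0; have /andP[h1 h2] := powR_primitive_bounds (p_ge0 k) (p_neq1 k0) c0 cD.
  rewrite -rhoE mulrC ger0_norm//; apply: le_trans h1.
  by rewrite mulr_ge0 ?powR_ge0// subr_ge0 ltW.
have Dc : 0 <= D - c by rewrite subr_ge0 ltW.
have [E hE] := cumulant_exists Dc Kle.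
exists E => //.
apply: (@squeeze_ccvg _ _ _ (fun n => h n * limn (series y))); last first.
  rewrite -[X in _ --> X](mul0r (limn (series y))).
  apply: cvgM; last exact: cvg_cst.
  by rewrite -(mulr0 (D - c)); apply: cvgM; [exact: cvg_cst|exact: cvg_harmonic].
apply: nearW => n; rewrite normcB.
pose s := [seq (c + i.+1%:R * h n) `^ (- alpha^-1) | i <- index_iota 0 n].
have := cumulantB hE (cumulant_points s (h n)); rewrite big_map.
apply: cumulant_le; first exact: ltW.
move=> k k0; rewrite big_map.
have /andP[h1 h2] := riemann_sum_powRN (p_ge0 k) (p_neq1 k0) c0 cD (erefl (h n)).
have -> : \sum_(j <- index_iota 0 n) ((c + j.+1%:R * h n) `^ (- alpha^-1)) ^+ k =
    \sum_(0 <= i < n) (c + i.+1%:R * h n) `^ (- p k).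
  by apply: eq_bigr => i _; rewrite powR_invX// ltr_wpDr// mulr_ge0// ltW.
by rewrite -rhoE ger0_norm.
Qed.

Hypothesis alpha2 : alpha < 2.

(** From k = 2 on, p k >= p 2 > 1, so the inverses decrease in absolute value; the other summand
    covers k = 1. *)
Let C := `|(1 - p 1)^-1| + `|(1 - p 2)^-1|.

Let C_ge k : (0 < k)%N -> `|(1 - p k)^-1| <= C.
Proof.
case: k => [//|[|k]] _; first by rewrite lerDl.
have p2 : 1 < p 2 by rewrite /p ltr_pdivlMr// mul1r.
have pk : p 2 <= p k.+2 by rewrite ler_pM2r ?invr_gt0// ler_nat.
apply: (@le_trans _ _ `|(1 - p 2)^-1|); last by rewrite lerDr.
rewrite !normfV lef_pV2 ?posrE ?normr_gt0 ?subr_eq0; last 2 first.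
- by rewrite eq_sym gt_eqF// (lt_le_trans p2).
- by rewrite eq_sym gt_eqF.
by rewrite !ltr0_norm ?subr_lt0// ?(lt_le_trans p2)// lerN2 lerD2l lerN2.
Qed.

Let C0 : 0 <= C. Proof. by rewrite addr_ge0. Qed.

(** At an integer D this is the sum of the b_j up to D ([sum_b_coef]). For alpha > 1 it is exactly
    the divergent part of the coefficient k = 1. *)
Definition compensator D := if 1 < alpha then powR_primitive (p 1) D else 0.

Lemma cumulant_limit : exists2 Einf,
  has_csum (cumulant_term (fun k => - powR_primitive (p k) c)) Einf &
  forall E : nat -> R[i],
    (forall n : nat, c < n%:R -> has_csum (cumulant_term (fun k =>
        powR_primitive (p k) n%:R - powR_primitive (p k) c)) (E n)) ->
    ccvg (fun n => E n - 'i%C * ((m 1 * u * compensator n%:R)%:C)%C) Einf.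
Proof.
have split_pow x k : 0 < x -> x `^ (1 - p k) = x * (x `^ (- alpha^-1)) ^+ k.
  move=> x0; rewrite powR_invX// powRD; last by rewrite (gt_eqF x0) implybT.
  by rewrite powRr1// ltW.
have cle k : (0 < k)%N -> `|- powR_primitive (p k) c| <= (c * C) * rho ^+ k.
  move=> k0; rewrite normrN normrM (ger0_norm (powR_ge0 _ _)) split_pow//.
  rewrite -/rho mulrAC; apply: ler_wpM2r => //.
  by rewrite ler_pM2l// C_ge.
have cC0 : 0 <= c * C by rewrite mulr_ge0// ltW.
have [Einf hE] := cumulant_exists cC0 cle.
exists Einf => // E hEn.
(* The first summand serves all k >= 2; the second serves k = 1 when it is not compensated, that is
   for alpha < 1. *)
pose eps (n : nat) : R := C * (n%:R `^ (- (p 2 - 1)) * rho ^- 2 +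
  (if 1 < alpha then 0 else n%:R `^ (- (p 1 - 1)) * rho ^- 1)).
have p2 : 1 < p 2 by rewrite /p ltr_pdivlMr// mul1r.
have eps_cvg : eps @ \oo --> (0 : R).
  rewrite -(mulr0 C); apply: cvgM; first exact: cvg_cst.
  rewrite -[X in _ --> X](addr0 0); apply: cvgD.
    rewrite -[X in _ --> X](mul0r (rho ^- 2)); apply: cvgM; last exact: cvg_cst.
    by apply: powRN_cvg0; rewrite subr_gt0.
  case: (ltP 1 alpha) => a1; first exact: cvg_cst.
  rewrite -[X in _ --> X](mul0r (rho ^- 1)); apply: cvgM; last exact: cvg_cst.
  apply: powRN_cvg0; rewrite subr_gt0 /p ltr_pdivlMr// mul1r lt_neqAle a1 andbT.
  by rewrite eq_sym alpha_nat.
apply: (@squeeze_ccvg _ _ _ (fun n => eps n * limn (series y))); last first.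
  rewrite -[X in _ --> X](mul0r (limn (series y))).
  by apply: cvgM => //; exact: cvg_cst.
near=> n.
have cn : c < n%:R by near: n; exact: nbhs_infty_gtr.
have n0 : 0 < n%:R :> R by exact: lt_trans cn.
have e20 : 0 <= n%:R `^ (- (p 2 - 1)) * rho ^- 2.
  by rewrite mulr_ge0 ?powR_ge0// invr_ge0.
have e10 : 0 <= (if 1 < alpha then 0 else n%:R `^ (- (p 1 - 1)) * rho ^- 1).
  by case: ifP => // _; rewrite mulr_ge0 ?powR_ge0// invr_ge0.
have := cumulantB (cumulantB (hEn n cn) (cumulant_single (compensator n%:R))) hE.
apply: cumulant_le; first by rewrite mulr_ge0 ?addr_ge0.
move=> k k0.
rewrite (_ : _ - _ - - _ = powR_primitive (p k) n%:R -
   (if k == 1%N then compensator n%:R else 0)); last by ring.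
(* Split n^(1 - p k) as n^(-(p j - 1)) n^(-p (k - j)): the second factor is at most [rho ^+ (k - j)]
   because n > c, and the first decays when p j > 1. *)
have tail j : (0 < j)%N -> (j <= k)%N ->
    `|powR_primitive (p k) n%:R| <= C * (n%:R `^ (- (p j - 1)) * rho ^- j) * rho ^+ k.
  move=> j0 jk; rewrite normrM (ger0_norm (powR_ge0 _ _)) mulrC -mulrA.
  rewrite ler_pM ?powR_ge0 ?C_ge//.
  have -> : 1 - p k = - (p j - 1) - p (k - j)%N.
    by rewrite /p natrB//; ring.
  rewrite powRD; last by rewrite (gt_eqF n0) implybT.
  rewrite -mulrA ler_wpM2l ?powR_ge0//.
  have -> : rho ^- j * rho ^+ k = rho ^+ (k - j)%N.
    by rewrite -{1}(subnK jk) exprD mulrCA mulVf ?mulr1// expf_neq0// gt_eqF.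
  rewrite /rho powR_invX//; apply: ler_powRN => //; exact: ltW.
case: (eqVneq k 1%N) => [k1|k1].
  rewrite k1 /compensator; case: ifP => a1.
    by rewrite subrr normr0; do 2!apply: mulr_ge0 => //; exact: addr_ge0.
  rewrite subr0 -k1; apply: le_trans (tail 1%N _ _) _ => //.
  by apply: ler_wpM2r => //; apply: ler_wpM2l => //; rewrite a1 lerDr.
rewrite subr0; apply: le_trans (tail 2%N _ _) _ => //.
  by rewrite ltn_neqAle eq_sym k1.
by apply: ler_wpM2r => //; apply: ler_wpM2l => //; rewrite lerDl.
Unshelve. all: by end_near. Qed.

End exponents.

(** * The residual *)

Lemma fsum_nat_eventually0 (R : realType) (z : nat -> R) m :
  (forall j, (m <= j)%N -> z j = 0) ->
  \sum_(j \in [set: nat]) z j = \sum_(0 <= j < m) z j.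
Proof.
move=> z0; have := @bigfs _ _ +%R _ (index_iota 0 m) predT z (iota_uniq _ _).
rewrite (_ : [set` predT] = setT); last by apply/seteqP; split.
move=> -> // i _; rewrite mem_index_iota/= -leqNgt; exact: z0.
Qed.

(** On [F m] all terms from m on vanish, so the partial sums cut off by the indicator of [F m]
    converge pointwise to the finitely supported sum. Outside every [F m] the support is infinite
    and both sides are 0. *)
Lemma measurable_fsum_nat d (T : measurableType d) (R : realType) (z : nat -> T -> R) :
  (forall j, measurable_fun [set: T] (z j)) ->
  measurable_fun [set: T] (fun w => \sum_(j \in [set: nat]) z j w).
Proof.
move=> mz.
pose F m := \bigcap_(j in [set j | (m <= j)%N]) (z j @^-1` [set 0]).
have mF m : measurable (F m).
  apply: bigcap_measurableType => j _.
  by rewrite -[_ @^-1` _]setTI; exact: mz.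
apply: (@measurable_fun_cvg _ _ _ _ (fun m w => \1_(F m) w * \sum_(0 <= j < m) z j w)).
  move=> m; apply: measurable_funM; first exact: measurable_indic.
  exact: measurable_sum.
move=> w _; have [[m Fm]|nF] := pselect (exists m, F m w).
  apply: cvg_near_cst; near=> n.
  have mn : (m <= n)%N by near: n; exact: nbhs_infty_ge.
  have Fn : F n w by move=> j /= nj; apply: Fm; exact: leq_trans nj.
  by rewrite indicE mem_set// mul1r (fsum_nat_eventually0 Fn).
apply: cvg_near_cst; apply: nearW => n.
rewrite indicE memNset ?mul0r; last by move=> Fn; apply: nF; exists n.
rewrite fsbig_dflt// => fin; apply: nF.
move/finite_fsetP: fin => [A EA].
exists (\max_(i <- finmap.enum_fset A) i).+1 => j /= jA; apply: contrapT => zj.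
have : ([set: nat] `&` z^~ w @^-1` [set~ 0]) j by split.
rewrite EA /= => jin; have := @leq_bigmax_seq _ (finmap.enum_fset A) xpredT (fun i => i) j jin isT.
by rewrite leqNgt jA.
Unshelve. all: by end_near. Qed.

Lemma ccvg_cvg (R : realType) (z : nat -> R[i]) (l : R[i]) :
  ccvg z l -> (z : nat -> R[i]^o) @ \oo --> (l : R[i]^o).
Proof.
move=> /ccvg_normcB zl; apply/cvgrPdist_lt => e e0.
(* In the order of [R[i]] a positive element is real. *)
have [r r0 ->] : exists2 r : R, 0 < r & e = (r%:C)%C.
  by case: e e0 => a b; rewrite ltcE/= => /andP[/eqP -> a0]; exists a.
move/cvgrPdist_lt: zl => /(_ r r0); apply: filterS => n.
rewrite sub0r normrN ger0_norm ?normc_ge0// normcB => h.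
rewrite (_ : `|_| = ((normc (l - z n))%:C)%C); last first.
  by rewrite normc_def; case: (l - z n).
by rewrite ltcR.
Qed.

Lemma cvg_in_distribution_charfun (R : realType)
    d (T : measurableType d) (P : probability T R) (X : nat -> T -> R)
    d' (T' : measurableType d') (P' : probability T' R) (Y : {RV P' >-> R}) (u : R) :
  cvg_in_distribution P X P' Y ->
  ccvg (fun n => Cmean P (fun w => cis (u * X n w))) (Cmean P' (fun w => cis (u * Y w))).
Proof.
move=> XY.
have mY : measurable_fun [set: T'] (fun w => u * Y w).
  by apply: measurable_funM => //; exact: measurable_funPT.
have K (f : R -> R) : continuous f -> (forall x, `|f x| <= 1) ->
    bounded_mfun (fun w => f (u * Y w)) ->
    (fun n => mean P (fun w => f (u * X n w))) @ \oo --> mean P' (fun w => f (u * Y w)).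
  move=> cf f1 bfY; apply: fine_cvg.
  have := XY (fun x => f (u * x)); rewrite /mean fineK.
    apply.
      move=> x; apply: continuous_comp; last exact: cf.
      by apply: cvgM; [exact: cvg_cst|exact: cvg_id].
    exists 1; split; first exact: num_real.
    by move=> y y1 x _ /=; apply: le_trans (f1 _) (ltW y1).
  by rewrite unlock; apply: integrable_fin_num => //; exact: bmf_integrable.
have [br bi] := bcmf_cis mY.
split.
- exact: (K (@cos R) (@continuous_cos R) (@cos_max R) br).
- exact: (K (@sin R) (@continuous_sin R) (@sin_max R) bi).
Qed.

(** * Characteristic function of the residual *)

Section residual_charfun.
Context d (T : measurableType d) (R : realType) (P : probability T R).
Variables (alpha mu sigma : R) (Gamma W : nat -> {RV P >-> R}) (c : R).
Hypothesis halpha : 0 < alpha < 2.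
Hypothesis halpha1 : alpha != 1.
Hypothesis hGamma : unit_poisson_arrivals Gamma.
Hypothesis hWind : mutually_independent P (fun j => W j : T -> R).
Hypothesis hWlaw : forall j (A : set R), measurable A ->
  distribution P (W j) A = gaussian_law mu sigma A.
Hypothesis hGW : independent_families P (fun j => Gamma j : T -> R)
  (fun j => W j : T -> R).
Hypothesis hc : 0 < c.

Let mW0 : measurable_fun [set: T] (W 0%N). Proof. exact: measurable_funPT. Qed.

Let expW r : (\int[P]_w (expR (r * `|W 0%N w|))%:E < +oo)%E.
Proof. exact: (gaussian_exp_integral_lty r (hWlaw 0%N)). Qed.

Let alpha0 : 0 < alpha. Proof. by case/andP: halpha. Qed.

Let alpha_nat k : (0 < k)%N -> k%:R != alpha.
Proof.
case: k => [//|[_|k _]]; first by rewrite eq_sym.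
case/andP: halpha => _ a2; rewrite gt_eqF// (lt_le_trans a2)// ler_nat.
by [].
Qed.

Let z (D : R) j w : R :=
  \1_(`]c, D[%classic) (Gamma j w) * (W j w * Gamma j w `^ (- alpha^-1)).

Let sum_jumps D w : \sum_(j \in [set j | c < Gamma j w < D])
    W j w * Gamma j w `^ (- alpha^-1) = \sum_(j \in [set: nat]) z D j w.
Proof.
rewrite fsbig_mkcond; apply: eq_fsbigr => j _; rewrite patchE /z indicE.
have -> : (Gamma j w \in `]c, D[%classic) = (j \in [set j | c < Gamma j w < D]).
  by apply/idP/idP => /set_mem /= h; apply/mem_set; move: h; rewrite /= in_itv.
by case: ifP => _; rewrite ?mul1r ?mul0r.
Qed.

Let mz D j : measurable_fun [set: T] (z D j).
Proof.
have mG : measurable_fun [set: T] (Gamma j) by exact: measurable_funPT.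
apply: measurable_funM.
  by apply: measurableT_comp; [exact: measurable_indic|exact: mG].
apply: measurable_funM; first exact: measurable_funPT.
by apply: (measurableT_comp (measurable_powR _)).
Qed.

Lemma sum_b_coef n : \sum_(1 <= j < n.+1) b_coef alpha j = compensator alpha n%:R.
Proof.
rewrite /compensator; case: ifP => a1; last first.
  by rewrite big1// => j _; rewrite /b_coef a1.
pose F j : R := alpha / (alpha - 1) * j%:R `^ ((alpha - 1) / alpha).
rewrite big_add1/= (eq_bigr (fun j => F j.+1 - F j)); last first.
  by move=> j _; rewrite /b_coef a1 mulrBr.
(* The lower end of the telescoping sum is a power of 0, which vanishes only for a nonzero
   exponent. *)
have q0 : (alpha - 1) / alpha != 0.
  by rewrite mulf_neq0 ?invr_neq0 ?subr_eq0// gt_eqF.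
rewrite telescope_sumr// /F powR0// mulr0 subr0 /powR_primitive.
have -> : 1 - 1 / alpha = (alpha - 1) / alpha by field; rewrite gt_eqF.
by rewrite invf_div mulrC.
Qed.

(** The compensator is deterministic, hence multiplies the characteristic function of the jump sum
    by a unimodular constant and subtracts its logarithm from the exponent, as [cumulant_limit]
    requires. *)
Lemma residual_charfun_limit (u : R) :
  exists2 E, has_csum (cumulant_term P (W 0%N) u
      (fun k => - powR_primitive (k%:R / alpha) c)) E &
    ccvg (fun n => Cmean P (fun w => cis (u * residual alpha Gamma W c n w))) (cexp E).
Proof.
have [N hN harr] := hGamma; have a2 : alpha < 2 by case/andP: halpha.
have [Einf h1 h2] := cumulant_limit mW0 expW u alpha0 hc alpha_nat a2.
exists Einf => //.
have /choice[E hE] : forall n : nat, exists E, c < n%:R ->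
    has_csum (cumulant_term P (W 0%N) u (fun k =>
      powR_primitive (k%:R / alpha) n%:R - powR_primitive (k%:R / alpha) c)) E /\
    Cmean P (fun w => cis (u * \sum_(j \in [set: nat]) z n%:R j w)) = cexp E.
  move=> n; have [cn|] := ltP c n%:R; last by exists 0.
  have [E hE1 hE2] := riemann_cumulant mW0 expW u alpha0 hc alpha_nat cn.
  exists E => _; split => //.
  apply: (@compound_poisson_charfun _ _ _ _ N Gamma W hN harr hWind _ hGW
    (fun x => x `^ (- alpha^-1)) c n%:R u) => //.
  - move=> j B mB; transitivity (distribution P (W j) B) => //.
    by rewrite hWlaw// -(hWlaw 0%N).
  - exact: ltW.
  - move=> x /andP[cx _]; apply: differentiable_continuous; apply/derivable1_diffP.
    by have [] := @is_derive1_powR R (- alpha^-1) x (lt_trans hc cx).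
  - exact: measurable_fsum_nat.
  (* When N_D <= M, arrivals of index at least M come after time D. *)
  - apply: filterS harr => w hG M NM; apply: fsum_nat_eventually0 => j Mj.
    rewrite /z indicE memNset ?mul0r//= in_itv/= => /andP[_ /ltW].
    by rewrite hG ?(ltW (lt_trans hc cn))// ltnNge (leq_trans NM).
apply: near_eq_ccvg (ccvg_cexp (h2 E (fun n cn => (hE n cn).1))); near=> n.
have cn : c < n%:R by near: n; exact: nbhs_infty_gtr.
have [_ hc'] := hE n cn.
rewrite addrC cexpD -hc' -CmeanZl; last first.
  by apply: bcmf_cis; apply: measurable_funM => //; exact: measurable_fsum_nat.
congr Cmean; apply/funext => w.
rewrite -mulrN -rmorphN -cis_cexp -cisD /residual sum_jumps sum_b_coef.
rewrite (_ : (fun w => W 0%N w ^+ 1) = W 0%N); first by congr cis; ring.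
by apply/funext => w'; rewrite expr1.
Unshelve. all: by end_near. Qed.

End residual_charfun.

(** Since 1 - k/alpha = (1 - k/2) + k (alpha - 2) / (2 alpha), the k-th power of the scale cancels
    all of the power of c except c^(1 - k/2). *)
Lemma zbar_term (R : realType) d (T : measurableType d) (P : probability T R)
    (alpha : R) (W : nat -> {RV P >-> R}) (c s : R) k :
  0 < alpha < 2 -> 0 < mean P (fun w => W 0%N w ^+ 2) -> 0 < c -> (2 < k)%N ->
  zbar alpha W c k * ((s%:C)%C) ^+ k =
  cumulant_term P (W 0%N) (s / Num.sqrt (residual_var alpha W c))
    (fun k => - powR_primitive (k%:R / alpha) c) k.
Proof.
move=> /andP[a0 a2] m2 c0 k2.
rewrite /zbar /cumulant_term; case: eqP k2 => [->//|_ k2].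
rewrite -[_ / k`!%:R]/(icoef k) -(mulrA (icoef k)) -(rmorphXn (real_complex R)).
rewrite -(rmorphM (real_complex R)).
congr (_ * (_%:C)%C).
set m := mean _ _; set V := mean _ _ * (alpha / (2 - alpha)).
have V0 : 0 < V by rewrite mulr_gt0// divr_gt0// subr_gt0.
have -> : Num.sqrt (residual_var alpha W c) =
    V `^ (2^-1) * c `^ ((alpha - 2) / alpha / 2).
  have V0' := ltW V0; rewrite /residual_var -/V -powR12_sqrt.
    by rewrite powRM ?powR_ge0// -powRrM.
  by apply: mulr_ge0 => //; exact: powR_ge0.
have -> : (s / (V `^ (2^-1) * c `^ ((alpha - 2) / alpha / 2))) ^+ k =
    s ^+ k / (V `^ (k%:R / 2) * c `^ ((alpha - 2) / alpha / 2 * k%:R)).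
  rewrite expr_div_n exprMn; congr (_ / (_ * _)).
    by rewrite -powR_mulrn ?powR_ge0// -powRrM mulrC.
  by rewrite -powR_mulrn ?powR_ge0// -powRrM.
rewrite /powR_primitive.
have E : 1 - k%:R / alpha = (1 - k%:R / 2) + (alpha - 2) / alpha / 2 * k%:R.
  by field; rewrite gt_eqF.
have -> : c `^ (1 - k%:R / alpha) =
    c `^ (1 - k%:R / 2) * c `^ ((alpha - 2) / alpha / 2 * k%:R).
  by rewrite E [LHS]powRD// (gt_eqF c0) implybT.
have cp := powR_gt0 ((alpha - 2) / alpha / 2 * k%:R) c0.
have Vp := powR_gt0 (k%:R / 2) V0.
have ka : alpha < k%:R by rewrite (lt_trans a2)// ltr_nat.
field.
by rewrite (gt_eqF a0) (gt_eqF cp) (gt_eqF Vp) !subr_eq0 (lt_eqF ka) (gt_eqF ka).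
Qed.

Theorem lemma2 (R : realType)
    (d : measure_display) (T : measurableType d) (P : probability T R)
    (d' : measure_display) (T' : measurableType d') (P' : probability T' R)
    (alpha mu sigma : R) (Gamma W : nat -> {RV P >-> R})
    (Rinf : {RV P' >-> R}) (c : R)
    (halpha : 0 < alpha < 2) (halpha1 : alpha != 1)
    (hsigma : 0 <= sigma)
    (hGamma : unit_poisson_arrivals Gamma)
    (hWind : mutually_independent P (fun j => W j : T -> R))
    (hWlaw : forall j (A : set R), measurable A ->
       distribution P (W j) A = gaussian_law mu sigma A)
    (hGW : independent_families P (fun j => Gamma j : T -> R)
                                  (fun j => W j : T -> R))
    (hW2 : 0 < mean P (fun w => W 0%N w ^+ 2))
    (hc : 0 < c)
    (hR : cvg_in_distribution P (residual alpha Gamma W c) P' Rinf)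
    (s : R) :
  cvgn (zbar_partial_sum alpha W c s) /\
  charfun P' (fun w => (Rinf w - residual_mean alpha W c) /
                       Num.sqrt (residual_var alpha W c)) s =
  cexp ((- s ^+ 2 / 2)%:C%C + limn (zbar_partial_sum alpha W c s)).

Proof.
set S := Num.sqrt _; set M := residual_mean _ _ _; pose u := s / S.
have [a0 a2] := andP halpha.
have V0 : 0 < residual_var alpha W c.
  by rewrite !mulr_gt0 ?powR_gt0 ?invr_gt0 ?subr_gt0.
have S0 : 0 < S by rewrite sqrtr_gt0.
have [E hE1 hE2] := residual_charfun_limit halpha halpha1 hGamma hWind hWlaw hGW hc u.
have hE3 : Cmean P' (fun w => cis (u * Rinf w)) = cexp E.
  exact: ccvg_unique (cvg_in_distribution_charfun u hR) hE2.
pose q := cumulant_term P (W 0%N) u (fun k => - powR_primitive (k%:R / alpha) c).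
have q0 : q 0%N = 0 by [].
(* The primitive for k = 1, negated at c, is alpha / (1 - alpha) c^((alpha - 1) / alpha): times the
   mean of W this is the centring. *)
have q1 : q 1%N = 'i%C * ((u * M)%:C)%C.
  rewrite /q /cumulant_term /= icoef1; congr (_ * (_%:C)%C).
  rewrite (_ : (fun w => W 0%N w ^+ 1) = W 0%N); last first.
    by apply/funext => w; rewrite expr1.
  rewrite expr1 /M /residual_mean /powR_primitive.
  have -> : 1 - 1 / alpha = (alpha - 1) / alpha by field; rewrite gt_eqF.
  field.
  by rewrite (gt_eqF a0) !subr_eq0 halpha1 eq_sym halpha1.
(* Likewise the second moment times the negated primitive is the variance, and u^2 S^2 = s^2. *)
have q2 : q 2%N = ((- s ^+ 2 / 2)%:C)%C.
  have i2 : icoef 2 = ((- 2^-1)%:C)%C :> R[i].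
    by rewrite /icoef sqr_i natrC -fmorphV mulN1r -rmorphN.
  rewrite /q /cumulant_term /= i2 -(rmorphM (real_complex R)); congr (_%:C)%C.
  rewrite /u expr_div_n /S sqr_sqrtr ?(ltW V0)// /residual_var /powR_primitive.
  have -> : 1 - 2 / alpha = (alpha - 2) / alpha by field; rewrite gt_eqF.
  have cp := powR_gt0 ((alpha - 2) / alpha) hc.
  field.
  by rewrite (gt_eqF a0) !subr_eq0 (lt_eqF a2) (gt_eqF a2) (gt_eqF cp) (gt_eqF hW2).
have hZ : ccvg (zbar_partial_sum alpha W c s) (E - q 1%N - q 2%N).
  have := ccvgD (ccvgD hE1 (ccvgN (ccvg_cst (q 1%N)))) (ccvgN (ccvg_cst (q 2%N))).
  apply: near_eq_ccvg; near=> n.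
  have n3 : (3 <= n)%N by near: n; exact: nbhs_infty_ge.
  rewrite /zbar_partial_sum (@big_cat_nat _ _ _ 3%N)//= -/q.
  rewrite big_ltn// big_ltn// big_ltn// big_geq// q0.
  rewrite (_ : \sum_(3 <= k < n) zbar _ _ _ _ * _ = \sum_(3 <= k < n) q k); first by ring.
  by apply: eq_big_nat => k /andP[k3 _]; rewrite zbar_term.
have cZ := ccvg_cvg hZ.
split; first by apply/cvg_ex; exists (E - q 1%N - q 2%N).
have -> : limn (zbar_partial_sum alpha W c s) = E - q 1%N - q 2%N.
  by apply: (cvg_lim _ cZ); exact: norm_hausdorff.
have mR : measurable_fun [set: T'] (fun w => u * Rinf w).
  by apply: measurable_funM => //; exact: measurable_funPT.
(* The constant factor cancels [q 1], leaving the exponent [q 2] plus the series from k = 3. *)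
transitivity (Cmean P' (fun w => cis (- (u * M)) * cis (u * Rinf w))).
  rewrite -[LHS]/(Cmean P' (fun w => cis (s * ((Rinf w - M) / S)))).
  by congr Cmean; apply/funext => w; rewrite -cisD; congr cis; rewrite /u; ring.
rewrite CmeanZl; last exact: bcmf_cis.
rewrite hE3 cis_cexp -cexpD; congr cexp.
by rewrite q1 q2 rmorphN; ring.
Unshelve. all: by end_near. Qed.
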